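(* Let $\mathcal{R}$ be Read's space. There exist closed subspaces $X$ of $c_0$ and $Y$ of $\mathcal{R}$ such that the set of tensors in $X\widehat{\otimes}_\pi Y^*$ which attain their projective norms is not dense in $X\widehat{\otimes}_\pi Y^*$.
   Context: Read's space $\mathcal{R}=(c_0,|||\cdot|||)$ is the following equivalent renorming of the real space $c_0$. Let $(u_n)_{n}$ be a sequence of finitely supported sequences with rational entries which lists every such finitely supported rational sequence infinitely many times, let $(a_n)_n$ be a strictly increasing sequence of positive integers with $a_n>\max\operatorname{supp}u_n$ and $a_n>\|u_n\|_1$ for every $n$, let $(e_k)$ be the unit vectors, and put $|||x|||=\|x\|_\infty+\sum_{n=1}^\infty 2^{-a_n^2}\,|\langle x,u_n-e_{a_n}\rangle|$ for $x\in c_0$. It is a known fact that the bidual $\mathcal{R}^{**}$ (with its bidual norm) is strictly convex. $X \widehat{\otimes}_\pi Z$ is the projective tensor product, the completion of $X \otimes Z$ under $\|z\|_\pi = \inf\{\sum_{n=1}^\infty \|x_n\|\|z_n\| : z = \sum_{n=1}^\infty x_n \otimes z_n,\ \sum_n\|x_n\|\|z_n\|<\infty\}$. An element $z\in X \widehat{\otimes}_\pi Z$ attains its projective norm if there is a bounded sequence $(x_n,z_n)\subseteq X\times Z$ with $\sum_n\|x_n\|\|z_n\|<\infty$, $z=\sum_n x_n\otimes z_n$ and $\|z\|_\pi=\sum_n\|x_n\|\|z_n\|$. The subspace $X$ carries the norm of $c_0$ and $Y$ carries the norm of $\mathcal{R}$. *)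

(* Defs.v *)
From HB Require Import structures.
From mathcomp Require Import all_boot all_order all_algebra.
From mathcomp Require Import all_classical all_reals.
From mathcomp Require Import ereal topology normedtype sequences.
From mathcomp Require Import lra.

Set Implicit Arguments.
Unset Strict Implicit.
Unset Printing Implicit Defensive.

Import Order.TTheory GRing.Theory Num.Theory.
Import numFieldNormedType.Exports.

Local Open Scope classical_set_scope.
Local Open Scope ring_scope.

Section sup_norm.
Context {R : realType} {T : Type}.
Implicit Types (D : set T) (f g : T -> R).

Definition sup_norm D f : R := sup [set `|f t| | t in D].

Definition bounded_onto D f := has_ubound [set `|f t| | t in D].

Lemma sup_norm_le D f t : bounded_onto D f -> D t -> `|f t| <= sup_norm D f.
Proof. by move=> fD Dt; apply: ub_le_sup => //; exists t. Qed.

Lemma sup_norm_ub D f (c : R) : D !=set0 -> (forall t, D t -> `|f t| <= c) ->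
  sup_norm D f <= c.
Proof.
move=> [t0 Dt0] fc; apply: ge_sup; first by exists `|f t0|, t0.
by move=> _ [t Dt <-]; exact: fc.
Qed.

Lemma sup_norm_ge0 D f : 0 <= sup_norm D f.
Proof.
rewrite /sup_norm; case: (pselect (has_sup [set `|f t| | t in D])) => [hs|].
  have [[_ [t Dt _]] ub] := hs.
  by rewrite (le_trans (normr_ge0 (f t)))// sup_norm_le.
by move=> /sup_out ->.
Qed.

Lemma sup_normD D f g : D !=set0 -> bounded_onto D f -> bounded_onto D g ->
  sup_norm D (f + g) <= sup_norm D f + sup_norm D g.
Proof.
move=> D0 bf bg; apply: sup_norm_ub => // t Dt.
by rewrite (le_trans (ler_normD _ _))// lerD// sup_norm_le.
Qed.

Lemma sup_normZ D (a : R) f : D !=set0 -> bounded_onto D f ->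
  sup_norm D (a *: f) = `|a| * sup_norm D f.
Proof.
move=> D0 bf; have [->|a0] := eqVneq a 0.
  rewrite normr0 mul0r; apply/eqP; rewrite eq_le sup_norm_ge0 andbT.
  by apply: sup_norm_ub => // t _; rewrite scale0r normr0.
have baf : bounded_onto D (a *: f).
  case: bf => M bf; exists (`|a| * M) => _ [t Dt <-].
  by rewrite normrM ler_wpM2l// bf//; exists t.
apply/eqP; rewrite eq_le; apply/andP; split.
  apply: sup_norm_ub => // t Dt; rewrite normrM ler_wpM2l//.
  exact: sup_norm_le.
rewrite -ler_pdivlMl ?normr_gt0//; apply: sup_norm_ub => // t Dt.
by rewrite ler_pdivlMl ?normr_gt0// -normrM (sup_norm_le baf).
Qed.

End sup_norm.

Section c0.
Context (R : realType).

Definition c0_pred : {pred nat -> R} := [pred x | `[< x @ \oo --> (0 : R) >] ].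

Lemma c0_predP x : reflect (x @ \oo --> (0 : R)) (x \in c0_pred).
Proof. exact: asboolP. Qed.

Lemma c0_submod : submod_closed c0_pred.
Proof.
split; first by apply/c0_predP; exact: cvg_cst.
move=> a x y /c0_predP x0 /c0_predP y0; apply/c0_predP.
by have := cvgD (cvgM (cvg_cst a) x0) y0; rewrite mulr0 addr0; exact.
Qed.

HB.instance Definition _ := GRing.isSubmodClosed.Build R (nat -> R) c0_pred
  c0_submod.

Record c0 := C0 { c0_val :> nat -> R; c0_valP : c0_val \in c0_pred }.
HB.instance Definition _ := [isSub for c0_val].
HB.instance Definition _ := [Choice of c0 by <:].
HB.instance Definition _ := [SubChoice_isSubLmodule of c0 by <:].

Lemma c0_cvg (x : c0) : x @ \oo --> (0 : R).
Proof. exact/c0_predP/c0_valP. Qed.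

Lemma c0_bounded (x : c0) : bounded_onto setT x.
Proof.
have [M [_ xM]] := cvg_seq_bounded (cvgP _ (@c0_cvg x)).
by exists (M + 1) => _ [n _ <-]; apply: xM => //; rewrite ltrDl.
Qed.

Lemma c0_norm0_eq0 (x : c0) : sup_norm setT x = 0 -> x = 0.
Proof.
move=> x0; apply/val_inj/funext => n /=; apply/eqP; rewrite -normr_le0 -x0.
by apply: sup_norm_le => //; exact: c0_bounded.
Qed.

Lemma c0_normD (x y : c0) :
  sup_norm setT (x + y) <= sup_norm setT x + sup_norm setT y.
Proof. by apply: sup_normD; [exists 0%N|exact: c0_bounded..]. Qed.

Lemma c0_normZ (a : R) (x : c0) :
  sup_norm setT (a *: x) = `|a| * sup_norm setT x.
Proof. by apply: sup_normZ; [exists 0%N|exact: c0_bounded]. Qed.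

HB.instance Definition _ := @Lmodule_isNormed.Build R c0
  (fun x : c0 => sup_norm setT x) c0_normD c0_normZ c0_norm0_eq0.

Lemma c0_normE (x : c0) : `|x| = sup_norm setT x. Proof. by []. Qed.

End c0.

Definition finsupp_rat (v : nat -> rat) :=
  exists m, forall k, (m <= k)%N -> v k = 0.

(* The sequences (u_n) and (a_n) from which Read's norm is built. Coordinates
   of c_0 are numbered from 1 in the definition of the norm, so that the entry
   of index k of a function on nat is the (k+1)-st coordinate: the support
   condition is stated with k.+1, the sum of |u_n| over k < a_n is the full
   1-norm, and e_{a_n} is the coordinate of index (a_n).-1. *)
Record read_data := ReadData {
  rd_u : nat -> nat -> rat;
  rd_a : nat -> nat;
  rd_a_gt0 : forall n, (0 < rd_a n)%N;
  rd_a_incr : {homo rd_a : m n / (m < n)%N};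
  rd_u_supp : forall n k, rd_u n k != 0 -> (k.+1 < rd_a n)%N;
  rd_u_norm1 : forall n, \sum_(k < rd_a n) `|rd_u n k| < (rd_a n)%:R;
  rd_u_lists : forall v, finsupp_rat v ->
    forall N, exists2 n, (N <= n)%N & rd_u n = v
}.

Lemma read_data_inhabited : inhabited read_data.
Proof.
pose s n : seq rat := odflt [::] (unpickle (logn 2 n)).
pose S n : rat := \sum_(x <- s n) `|x|.
pose b n := (size (s n) + (Num.truncn (S n)).+1).+1.
pose a n := (\sum_(i < n.+1) b i)%N.
have ba n : (b n <= a n)%N by rewrite /a big_ord_recr leq_addl.
have Sle n m : \sum_(k < m) `|nth 0 (s n) k| <= S n.
  rewrite /S; elim: (s n) m => [|x r ih] [|m].
  - by rewrite big_ord0 big_nil.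
  - by rewrite big_nil big1// => i _; rewrite nth_nil normr0.
  - by rewrite big_ord0 sumr_ge0.
  - by rewrite big_ord_recl big_cons/= lerD2l; exact: ih.
split; refine (@ReadData (fun n => nth 0 (s n)) a _ _ _ _ _).
- by move=> n; rewrite (leq_trans _ (ba n)).
- apply: homo_ltn => [m n p|n]; first exact: ltn_trans.
  by rewrite [in ltnRHS]/a big_ord_recr -[ltnLHS]addn0 ltn_add2l.
- move=> n k uk; apply: leq_trans (ba n); rewrite /b ltnS.
  have : (k < size (s n))%N.
    by rewrite ltnNge; apply: contraNN uk => ks; rewrite nth_default.
  by move=> ks; rewrite (leq_trans ks)// leq_addr.
- move=> n; rewrite (le_lt_trans (Sle n _))// (lt_le_trans (truncnS_gt _))//.
  by rewrite ler_nat (leq_trans _ (ba n))// /b leqW// leq_addl.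
- move=> v [m vm] N; pose p := pickle (mkseq v m).
  exists (2 ^ p * N.*2.+1)%N.
    rewrite (@leq_trans N.*2.+1)//; first by rewrite -addnn leqW// leq_addl.
    by rewrite leq_pmull// expn_gt0.
  apply/funext => k.
  have -> : s (2 ^ p * N.*2.+1)%N = mkseq v m.
    have e : logn 2 (2 ^ p * N.*2.+1) = p.
      by rewrite lognM ?expn_gt0// pfactorK// lognE/= dvdn2/= odd_double/= addn0.
    by rewrite /s e pickleK.
  have [km|mk] := ltnP k m; first by rewrite nth_mkseq.
  by rewrite vm// nth_default// size_mkseq.
Qed.

Section read.
Context (R : realType) (d : read_data).
Implicit Types (x y : c0 R) (n : nat).

Definition read_pairing x n : R :=
  \sum_(k < rd_a d n) ratr (rd_u d n k) * x k - x (rd_a d n).-1.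

Definition read_weight n : R := 2^-1 ^+ (rd_a d n ^ 2).

Definition read_norm x : R :=
  `|x| + limn (series (fun n => read_weight n * `|read_pairing x n|)).

Lemma read_pairingP a x y n :
  read_pairing (a *: x + y) n = a * read_pairing x n + read_pairing y n.
Proof.
rewrite /read_pairing mulrBr mulr_sumr addrACA -opprD -big_split/=.
by congr (_ - _); apply: eq_bigr => k _; rewrite mulrDr mulrCA.
Qed.

Lemma read_ltn_a n : (n < rd_a d n)%N.
Proof.
elim: n => [|n ih]; first exact: rd_a_gt0.
by apply: leq_ltn_trans ih _; apply: rd_a_incr.
Qed.

Lemma read_weight_ge0 n : 0 <= read_weight n.
Proof. by rewrite exprn_ge0// invr_ge0. Qed.

Lemma read_weight_le n : read_weight n * (rd_a d n).+1%:R <= 2^-1 ^+ n.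
Proof.
have [a an] : exists a, rd_a d n = a.+1.
  by exists (rd_a d n).-1; rewrite prednK// rd_a_gt0.
have na : (n <= a)%N by have := read_ltn_a n; rewrite an ltnS.
have pw : (a.+2%:R <= 2 ^+ a.+1 :> R).
  by rewrite -natrX ler_nat; exact: ltn_expl.
apply: le_trans (_ : read_weight n * 2 ^+ a.+1 <= _).
  by rewrite an ler_wpM2l// read_weight_ge0.
rewrite /read_weight an.
have -> : (a.+1 ^ 2 = a.+1 * a + a.+1)%N by rewrite expnS expn1 mulnS addnC.
rewrite exprD -mulrA -exprMn mulVf ?pnatr_eq0// expr1n mulr1.
rewrite ler_wiXn2l// ?invr_ge0// ?invf_le1// ?ler1n//.
by rewrite (leq_trans na)// leq_pmull.
Qed.

Lemma c0_le_norm x k : `|x k| <= `|x|.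
Proof. by apply: sup_norm_le => //; exact: c0_bounded. Qed.

Lemma read_pairing_le x n : `|read_pairing x n| <= `|x| * (rd_a d n).+1%:R.
Proof.
rewrite -addn1 natrD mulrDr mulr1 (le_trans (ler_normB _ _))// lerD ?c0_le_norm//.
rewrite (le_trans (ler_norm_sum _ _ _))//.
apply: (@le_trans _ _ (\sum_(k < rd_a d n) `|x| * ratr `|rd_u d n k|)).
  apply: ler_sum => k _; rewrite normrM mulrC ratr_norm ler_wpM2r//.
  exact: c0_le_norm.
rewrite -mulr_sumr ler_wpM2l// -rmorph_sum/= -(ratr_nat R) ler_rat ltW//.
exact: rd_u_norm1.
Qed.

Lemma read_term_le x n :
  read_weight n * `|read_pairing x n| <= `|x| * 2^-1 ^+ n.
Proof.
apply: le_trans (_ : read_weight n * (`|x| * (rd_a d n).+1%:R) <= _).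
  by rewrite ler_wpM2l ?read_weight_ge0// read_pairing_le.
by rewrite mulrCA ler_wpM2l// read_weight_le.
Qed.

Lemma read_term_ge0 x n : 0 <= read_weight n * `|read_pairing x n|.
Proof. by rewrite mulr_ge0// read_weight_ge0. Qed.

Lemma read_cvg x : cvgn (series (fun n => read_weight n * `|read_pairing x n|)).
Proof.
apply: (@series_le_cvg _ _ (fun n => `|x| * 2^-1 ^+ n)).
- exact: read_term_ge0.
- by move=> n; rewrite mulr_ge0// exprn_ge0// invr_ge0.
- exact: read_term_le.
apply: is_cvg_geometric_series; rewrite ger0_norm ?invr_ge0//.
by rewrite invf_lt1// ltr1n.
Qed.

(* read_norm_ge and read_norm_le: the norm is equivalent to the sup norm. *)
Lemma read_norm_ge x : `|x| <= read_norm x.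
Proof.
rewrite lerDl; apply: limr_ge; first exact: read_cvg.
by apply: nearW => n; rewrite sumr_ge0// => i _; exact: read_term_ge0.
Qed.

Lemma read_norm_le x : read_norm x <= 3 * `|x|.
Proof.
rewrite (_ : 3 = 1 + 2)// mulrDl mul1r lerD2l.
apply: limr_le; first exact: read_cvg.
apply: nearW => n; apply: le_trans (_ : series (geometric `|x| 2^-1) n <= _).
  by apply: ler_sum => i _; exact: read_term_le.
rewrite geometric_seriesE ?lt_eqF ?invf_lt1 ?ltr1n//.
rewrite (_ : (1 - 2^-1)= 2^-1 :> R) ?invrK; last first.
  by rewrite [X in X - _](splitr 1) div1r addrK.
by rewrite [leRHS]mulrC /= ler_wpM2r// ler_piMr// gerBl exprn_ge0// invr_ge0.
Qed.

Lemma read_normD x y : read_norm (x + y) <= read_norm x + read_norm y.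
Proof.
rewrite /read_norm addrACA lerD ?ler_normD//.
rewrite -limD; [|exact: read_cvg..].
apply: ler_lim; [exact: read_cvg|apply: is_cvgD; exact: read_cvg|].
apply: nearW => n /=; rewrite fctE /series/= -big_split/=.
apply: ler_sum => k _; rewrite -mulrDr ler_wpM2l ?read_weight_ge0//.
by have := read_pairingP 1 x y k; rewrite scale1r mul1r => ->; rewrite ler_normD.
Qed.

Lemma read_normZ (a : R) x : read_norm (a *: x) = `|a| * read_norm x.
Proof.
rewrite /read_norm normrZ mulrDr; congr (_ + _).
rewrite -[RHS](lim_seriesZ `|a| (@read_cvg x)).
congr (limn (series _)); apply/funext => k /=.
have := read_pairingP a x 0 k; rewrite addr0 => ->.
have -> : read_pairing 0 k = 0.
  by rewrite /read_pairing subr0 big1// => i _; rewrite mulr0.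
by rewrite addr0 normrM mulrCA.
Qed.

Lemma read_norm0_eq0 x : read_norm x = 0 -> x = 0.
Proof.
by move=> x0; apply/eqP; rewrite -normr_le0 -x0 read_norm_ge.
Qed.

End read.

Definition read_space (R : realType) (d : read_data) : Type := c0 R.

Section read_space.
Context (R : realType) (d : read_data).
Local Notation read_space := (read_space R d).

HB.instance Definition _ := GRing.Lmodule.copy read_space (c0 R).
HB.instance Definition _ := @Lmodule_isNormed.Build R read_space
  (@read_norm R d) (@read_normD R d) (@read_normZ R d) (@read_norm0_eq0 R d).

Lemma read_normE (x : read_space) : `|x| = read_norm d x.
Proof. by []. Qed.

End read_space.

(* Closed linear subspaces of V; csub S is S with the norm of V. *)
Record csubspace (R : realType) (V : normedModType R) := CSubspace {
  csub_set :> set V;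
  csub0 : csub_set 0;
  csub_lin : forall (a : R) x y, csub_set x -> csub_set y ->
    csub_set (a *: x + y);
  csub_closed : closed csub_set
}.

Section csubspace_type.
Context (R : realType) (V : normedModType R) (S : csubspace V).

Definition csub_pred : {pred V} := [pred x | x \in (S : set V)].

Lemma csub_submod : submod_closed csub_pred.
Proof.
split; first by apply/mem_set; exact: csub0.
by move=> a x y /set_mem Sx /set_mem Sy; apply/mem_set; exact: csub_lin.
Qed.

HB.instance Definition _ := GRing.isSubmodClosed.Build R V csub_pred
  csub_submod.

Record csub := CSub { csub_val :> V; csub_valP : csub_val \in csub_pred }.
HB.instance Definition _ := [isSub for csub_val].
HB.instance Definition _ := [Choice of csub by <:].
HB.instance Definition _ := [SubChoice_isSubLmodule of csub by <:].

Lemma csub_normD (x y : csub) :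
  `|csub_val (x + y)| <= `|csub_val x| + `|csub_val y|.
Proof. exact: ler_normD. Qed.

Lemma csub_normZ (a : R) (x : csub) :
  `|csub_val (a *: x)| = `|a| * `|csub_val x|.
Proof. exact: normrZ. Qed.

Lemma csub_norm0_eq0 (x : csub) : `|csub_val x| = 0 -> x = 0.
Proof. by move=> x0; apply/val_inj/normr0_eq0. Qed.

HB.instance Definition _ := @Lmodule_isNormed.Build R csub
  (fun x : csub => `|csub_val x|) csub_normD csub_normZ csub_norm0_eq0.

End csubspace_type.

Section dual.
Context (R : realType) (V : normedModType R).

Definition dual_pred : {pred V -> R} :=
  [pred f : V -> R | `[< linear f /\ continuous f >] ].

Lemma dual_predP (f : V -> R) :
  reflect (linear f /\ continuous f) (f \in dual_pred).
Proof. exact: asboolP. Qed.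

Lemma dual_submod : submod_closed dual_pred.
Proof.
split.
  apply/dual_predP; split; last by move=> x; exact: cvg_cst.
  by move=> a x y; rewrite /= scaler0 addr0.
move=> a f g /dual_predP[lf cf] /dual_predP[lg cg]; apply/dual_predP; split.
  move=> b x y; rewrite /= !fctE lf lg /=.
  by rewrite !scalerDr addrACA !scalerA mulrC.
move=> x; apply: (@cvgD _ _ _ (nbhs x)); last exact: cg.
by apply: (@cvgM _ _ (nbhs x)); [exact: cvg_cst|exact: cf].
Qed.

HB.instance Definition _ := GRing.isSubmodClosed.Build R (V -> R) dual_pred
  dual_submod.

Record dual := Dual { dual_val :> V -> R; dual_valP : dual_val \in dual_pred }.
HB.instance Definition _ := [isSub for dual_val].
HB.instance Definition _ := [Choice of dual by <:].
HB.instance Definition _ := [SubChoice_isSubLmodule of dual by <:].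

Implicit Types f g : dual.

Lemma dual_linear f : linear f.
Proof. by case/dual_predP: (dual_valP f). Qed.

Lemma dual_continuous f : continuous f.
Proof. by case/dual_predP: (dual_valP f). Qed.

Definition unit_ball : set V := [set x | `|x| <= 1].

Lemma unit_ball0 : unit_ball !=set0.
Proof. by exists 0; rewrite /unit_ball/= normr0. Qed.

Definition dual_linfun f : {linear V -> R} :=
  HB.pack (dual_val f) (GRing.isLinear.Build R V R _ (dual_val f) (@dual_linear f)).

Lemma dual_bounded f : bounded_onto unit_ball f.
Proof.
have : bounded_near (dual_linfun f) (nbhs 0).
  by apply/linear_bounded_continuous; exact: dual_continuous.
move=> /bounded_funP/(_ 1)[M fM].
by exists M => _ [x x1 <-]; exact: fM.
Qed.

Lemma dual_norm0_eq0 f : sup_norm unit_ball f = 0 -> f = 0.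
Proof.
move=> f0; apply/val_inj/funext => x /=.
have [->|x0] := eqVneq x 0; first exact: (linear0 (dual_linfun f)).
have nx0 : `|x| != 0 by rewrite normr_eq0.
have : `|f (`|x|^-1 *: x)| <= 0.
  rewrite -f0; apply: sup_norm_le; first exact: dual_bounded.
  by rewrite /unit_ball/= normrZ normfV normr_id mulVf.
have fZ a y : f (a *: y) = a *: f y := linearZZ (dual_linfun f) a y.
rewrite fZ normrZ normfV normr_id pmulr_rle0 ?invr_gt0//.
  by rewrite normr_le0 => /eqP.
by rewrite normr_gt0.
Qed.

Lemma dual_normD f g :
  sup_norm unit_ball (f + g) <= sup_norm unit_ball f + sup_norm unit_ball g.
Proof. by apply: sup_normD; [exact: unit_ball0|exact: dual_bounded..]. Qed.

Lemma dual_normZ (a : R) f :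
  sup_norm unit_ball (a *: f) = `|a| * sup_norm unit_ball f.
Proof. by apply: sup_normZ; [exact: unit_ball0|exact: dual_bounded]. Qed.

HB.instance Definition _ := @Lmodule_isNormed.Build R dual
  (fun f : dual => sup_norm unit_ball f) dual_normD dual_normZ dual_norm0_eq0.

Lemma dual_normE f : `|f| = sup [set `|f x| | x in [set x : V | `|x| <= 1]].
Proof. by []. Qed.

End dual.

Record seminorm (R : realType) (M : lmodType R) := Seminorm {
  sn_fun :> M -> R;
  sn_normD : forall x y, sn_fun (x + y) <= sn_fun x + sn_fun y;
  sn_normZ : forall (a : R) x, sn_fun (a *: x) = `|a| * sn_fun x
}.

Section seminorm_theory.
Context (R : realType) (M : lmodType R) (q : seminorm M).

Lemma sn_norm0 : q 0 = 0.
Proof. by rewrite -(scale0r (0 : M)) sn_normZ normr0 mul0r. Qed.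

Lemma sn_normN x : q (- x) = q x.
Proof. by rewrite -scaleN1r sn_normZ normrN1 mul1r. Qed.

Lemma sn_normBC x y : q (x - y) = q (y - x).
Proof. by rewrite -opprB sn_normN. Qed.

Lemma sn_norm_ge0 x : 0 <= q x.
Proof.
have := sn_normD q x (- x); rewrite subrr sn_norm0 sn_normN -mulr2n.
by rewrite pmulrn_lge0.
Qed.

Lemma sn_normB x y : q x - q y <= q (x - y).
Proof. by rewrite lerBlDr (le_trans _ (sn_normD _ _ _))// subrK. Qed.

Lemma sn_norm_dist x y : `|q x - q y| <= q (x - y).
Proof.
by rewrite ler_norml sn_normB andbT lerNl opprB sn_normBC sn_normB.
Qed.

Lemma sn_norm_tri y x z : q (x - z) <= q (x - y) + q (y - z).
Proof. by rewrite (le_trans _ (sn_normD _ _ _))// addrA subrK. Qed.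

End seminorm_theory.

(* The quotient of M by the kernel of q, with the norm induced by q. *)
Section separation.
Local Open Scope quotient_scope.
Context (R : realType) (M : lmodType R) (q : seminorm M).

Definition null_pred : {pred M} := [pred x | q x == 0].

Lemma null_zmod : zmod_closed null_pred.
Proof.
split; first by rewrite inE sn_norm0.
move=> x y; rewrite !inE => /eqP x0 /eqP y0; rewrite eq_le sn_norm_ge0 andbT.
by rewrite (le_trans (sn_normD _ _ _))// sn_normN x0 y0 addr0.
Qed.

HB.instance Definition _ := GRing.isZmodClosed.Build M null_pred null_zmod.

Definition sep : Type := Quotient.quot null_pred.
HB.instance Definition _ := GRing.Zmodule.on sep.

Definition to_sep (x : M) : sep := \pi_(Quotient.quot null_pred) x.
Definition of_sep (x : sep) : M := repr (x : Quotient.quot null_pred).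

Lemma of_sepK : cancel of_sep to_sep.
Proof. exact: reprK. Qed.

Lemma to_sepP x y : to_sep x = to_sep y <-> q (x - y) = 0.
Proof.
have := Quotient.idealrBE null_pred x y; rewrite inE => e.
split=> [/eqP|/eqP]; first by rewrite /to_sep -[_ == _]e => /eqP.
by rewrite e => /eqP.
Qed.

Lemma to_sepD x y : to_sep (x + y) = to_sep x + to_sep y.
Proof. exact: (raddfD \pi_(Quotient.quot null_pred)). Qed.

Lemma of_to_sep x : q (of_sep (to_sep x) - x) = 0.
Proof. by apply/to_sepP; rewrite of_sepK. Qed.

Definition sep_scale (a : R) (x : sep) := to_sep (a *: of_sep x).

Lemma to_sepZ a x : to_sep (a *: x) = sep_scale a (to_sep x).
Proof.
apply/esym/to_sepP.
by rewrite -scalerBr sn_normZ of_to_sep mulr0.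
Qed.

Let sep_scaleA a b x : sep_scale a (sep_scale b x) = sep_scale (a * b) x.
Proof. by rewrite -(of_sepK x) -!to_sepZ scalerA. Qed.

Let sep_scale1 : left_id 1 sep_scale.
Proof. by move=> x; rewrite -(of_sepK x) -!to_sepZ scale1r. Qed.

Let sep_scaleDr : right_distributive sep_scale +%R.
Proof.
move=> a x y; rewrite -(of_sepK x) -(of_sepK y) -to_sepD -!to_sepZ.
by rewrite scalerDr to_sepD.
Qed.

Let sep_scaleDl x : {morph sep_scale^~ x : a b / a + b}.
Proof.
by move=> a b; rewrite -(of_sepK x) -!to_sepZ scalerDl to_sepD.
Qed.

HB.instance Definition _ := GRing.Zmodule_isLmodule.Build R sep
  sep_scaleA sep_scale1 sep_scaleDr sep_scaleDl.

Definition sep_norm (x : sep) := q (of_sep x).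

Lemma sep_normE x : sep_norm (to_sep x) = q x.
Proof.
apply/eqP; rewrite -subr_eq0 -normr_le0 (le_trans (sn_norm_dist _ _ _))//.
by rewrite of_to_sep.
Qed.

Let sep_normD x y : sep_norm (x + y) <= sep_norm x + sep_norm y.
Proof.
by rewrite -(of_sepK x) -(of_sepK y) -to_sepD !sep_normE sn_normD.
Qed.

Let sep_normZ (a : R) x : sep_norm (a *: x) = `|a| * sep_norm x.
Proof. by rewrite sep_normE sn_normZ. Qed.

Let sep_norm0_eq0 x : sep_norm x = 0 -> x = 0.
Proof.
have -> : 0 = to_sep 0 by exact/esym/(raddf0 \pi_(Quotient.quot null_pred)).
by move=> x0; rewrite -[LHS]of_sepK; apply/to_sepP; rewrite subr0.
Qed.

HB.instance Definition _ := @Lmodule_isNormed.Build R sep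
  sep_norm sep_normD sep_normZ sep_norm0_eq0.

Lemma to_sep_linear : linear to_sep.
Proof. by move=> a x y; rewrite to_sepD to_sepZ. Qed.

Lemma to_sep_norm x : `|to_sep x| = q x.
Proof. exact: sep_normE. Qed.

HB.instance Definition _ := GRing.isLinear.Build R M sep _ to_sep to_sep_linear.

End separation.

(* The separated completion of (W, p): Cauchy sequences modulo null sequences.
   See to_completion_norm, to_completion_dense and completion_complete. *)
Section completion.
Context (R : realType) (W : lmodType R) (p : seminorm W).

Definition cauchy_for (u : nat -> W) := forall e : R, 0 < e ->
  exists N, forall m n, (N <= m)%N -> (N <= n)%N -> p (u m - u n) < e.

Definition cauchy_pred : {pred nat -> W} := [pred u | `[< cauchy_for u >] ].

Lemma cauchy_predP u : reflect (cauchy_for u) (u \in cauchy_pred).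
Proof. exact: asboolP. Qed.

Lemma cauchy_submod : submod_closed cauchy_pred.
Proof.
split.
  by apply/cauchy_predP => e e0; exists 0%N => m n _ _; rewrite subrr sn_norm0.
move=> a u v /cauchy_predP cu /cauchy_predP cv; apply/cauchy_predP => e e0.
have a0 : 0 < `|a| + 1 by rewrite ltr_wpDl.
have [N1 uN] := cu (e / 2 / (`|a| + 1)) ltac:(by rewrite !divr_gt0).
have [N2 vN] := cv (e / 2) ltac:(by rewrite divr_gt0).
exists (maxn N1 N2) => m n; rewrite !geq_max => /andP[m1 m2] /andP[n1 n2].
rewrite !fctE opprD addrACA -scalerBr (le_lt_trans (sn_normD _ _ _))//.
rewrite [e in ltRHS]splitr ler_ltD// ?vN//.
rewrite sn_normZ (@le_trans _ _ ((`|a| + 1) * p (u m - u n)))//.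
  by rewrite ler_wpM2r ?sn_norm_ge0// lerDl.
by rewrite mulrC -ler_pdivlMr// ltW// uN.
Qed.

HB.instance Definition _ := GRing.isSubmodClosed.Build R (nat -> W) cauchy_pred
  cauchy_submod.

Record cseq := CSeq { cseq_val :> nat -> W; cseq_valP : cseq_val \in cauchy_pred }.
HB.instance Definition _ := [isSub for cseq_val].
HB.instance Definition _ := [Choice of cseq by <:].
HB.instance Definition _ := [SubChoice_isSubLmodule of cseq by <:].

Definition cseq_norm (u : cseq) : R := limn (p \o u).

Lemma cseq_cvg (u : cseq) : cvgn (p \o u).
Proof.
apply/cauchy_cvgP/cauchy_exP => e e0.
have /cauchy_predP/(_ e e0)[N uN] := cseq_valP u.
exists (p (u N)); exists N => // n Nn; rewrite /ball/=.
by rewrite (le_lt_trans (sn_norm_dist _ _ _))// uN.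
Qed.

Lemma cseq_normD u v : cseq_norm (u + v) <= cseq_norm u + cseq_norm v.
Proof.
rewrite /cseq_norm -limD; [|exact: cseq_cvg..].
apply: ler_lim; [exact: cseq_cvg|apply: is_cvgD; exact: cseq_cvg|].
by apply: nearW => n /=; exact: sn_normD.
Qed.

Lemma cseq_normZ (a : R) u : cseq_norm (a *: u) = `|a| * cseq_norm u.
Proof.
rewrite /cseq_norm -[RHS](limZl_tmp `|a| (@cseq_cvg u)).
by congr (limn _); apply/funext => n /=; exact: sn_normZ.
Qed.

Definition cseq_seminorm := Seminorm cseq_normD cseq_normZ.

Lemma cauchy_cst (w : W) : cst w \in cauchy_pred.
Proof.
by apply/cauchy_predP => e e0; exists 0%N => m n _ _; rewrite subrr sn_norm0.
Qed.

Definition cseq_cst (w : W) := CSeq (cauchy_cst w).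

Lemma cseq_cst_linear : linear cseq_cst.
Proof. by move=> a u v; apply/val_inj. Qed.

Definition completion : Type := sep cseq_seminorm.
HB.instance Definition _ := NormedModule.on completion.

Definition to_completion (w : W) : completion := to_sep _ (cseq_cst w).

Lemma to_completion_linear : linear to_completion.
Proof.
by move=> a u v; rewrite /to_completion cseq_cst_linear to_sep_linear.
Qed.

HB.instance Definition _ :=
  GRing.isLinear.Build R W completion _ to_completion to_completion_linear.

Lemma to_completion_norm (w : W) : `|to_completion w| = p w.
Proof.
rewrite [LHS]to_sep_norm /= /cseq_norm.
by apply: (@cvg_lim R) => //; exact: (cvg_cst (p w)).
Qed.

Lemma to_completion_cvg (u : cseq) :
  to_completion (u n) @[n --> \oo] --> (to_sep _ u : completion).
Proof.
apply/cvgrPdist_lt => e e0.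
have /cauchy_predP/(_ _ (divr_gt0 e0 (ltr0n _ 2)))[N uN] := cseq_valP u.
exists N => // n /= Nn.
have -> : to_sep cseq_seminorm u - to_completion (u n) =
  to_sep cseq_seminorm (u - cseq_cst (u n)) by rewrite raddfB.
rewrite to_sep_norm (@le_lt_trans _ _ (e / 2))//; last first.
  by rewrite ltr_pdivrMr// ltr_pMr// ltr1n.
apply: limr_le; first exact: cseq_cvg.
by exists N => // m /= Nm; rewrite ltW// uN.
Qed.

Lemma to_completion_dense : dense (range to_completion).
Proof.
move=> O [t Ot] Oo; rewrite -(of_sepK t) in Ot.
have /= [N _ NO] := to_completion_cvg (open_nbhs_nbhs (conj Oo Ot)).
by exists (to_completion (of_sep t N)); split; [by apply: NO => /=|exists (of_sep t N)].
Qed.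

Lemma completion_approx (t : completion) (e : R) : 0 < e ->
  exists w, `|t - to_completion w| < e.
Proof.
move=> e0.
have [x [/= te [w _ wE]]] := @to_completion_dense (ball t e)
  (ex_intro _ t (ballxx t e0)) (ball_open t e).
by exists w; move: te; rewrite wE -ball_normE.
Qed.

Lemma completion_complete (F : set_system completion) :
  ProperFilter F -> cauchy F -> cvg F.
Proof.
move=> FF /cauchyP Fc.
pose r n : R := n.+1%:R^-1.
have r0 n : 0 < r n by rewrite invr_gt0.
have [t Ft] := choice (fun n => Fc (r n) (r0 n)).
have [w tw] := choice (fun n => completion_approx (t n) (r0 n)).
have Fw n : F (ball (to_completion (w n)) (r n + r n)).
  apply: filterS (Ft n) => x; rewrite -ball_normE /= => xt.
  rewrite -(subrK (t n) (to_completion _)) -addrA.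
  by rewrite (le_lt_trans (ler_normD _ _))// ltrD// distrC.
have rsmall (e : R) : 0 < e -> exists N, forall n, (N <= n)%N -> r n + r n < e.
  move=> e0; exists (Num.truncn (2 / e)) => n Nn.
  rewrite -mulr2n -mulr_natl -ltr_pdivlMl ?ltr0n//.
  rewrite /r -[ltRHS]invrK ltf_pV2 ?posrE ?invr_gt0 ?mulr_gt0 ?invr_gt0//.
  rewrite invfM invrK (lt_le_trans (truncnS_gt _))//.
  by rewrite ler_nat ltnS.
have wc : w \in cauchy_pred.
  apply/cauchy_predP => e e0.
  have [N rN] := rsmall (e / 2) ltac:(by rewrite divr_gt0).
  exists N => m n Nm Nn; rewrite -to_completion_norm raddfB/=.
  have [x [xm xn]] := filter_ex (filterI (Fw m) (Fw n)).
  move: xm xn; rewrite -!ball_normE /= => xm xn.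
  rewrite -(subrK x (to_completion (w m))) -addrA.
  rewrite (le_lt_trans (ler_normD _ _))// [e]splitr ltrD//.
    exact: lt_trans (rN _ Nm).
  by rewrite distrC; exact: lt_trans (rN _ Nn).
apply/cvg_ex; exists (to_sep _ (CSeq wc) : completion).
apply/cvgrPdist_lt => e e0.
have /cvgrPdist_lt/(_ _ (divr_gt0 e0 (ltr0n _ 2)))[N1 _ wN] :=
  @to_completion_cvg (CSeq wc).
have [N2 rN] := rsmall (e / 2) ltac:(by rewrite divr_gt0).
pose N := maxn N1 N2.
apply: filterS (Fw N) => x; rewrite -ball_normE /= => xN.
rewrite -(subrK (to_completion (w N)) (to_sep _ _)) -addrA.
rewrite (le_lt_trans (ler_normD _ _))// [e]splitr ltrD//.
  by apply: wN; rewrite /= leq_maxl.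
by apply: lt_trans xN (rN _ _); rewrite leq_maxr.
Qed.

HB.instance Definition _ :=
  Uniform_isComplete.Build completion completion_complete.

End completion.

(* The algebraic tensor product of X and Z, as the span of the evaluations
   B |-> B x z in the space of functionals on the bilinear forms on X x Z. *)
Section algebraic_tensor.
Context (R : realType) (X Z : lmodType R).

Definition bilform := {bilinear X -> Z -> R}.

Definition eval_tensor (x : X) (z : Z) : bilform -> R := fun B => B x z.

Definition tensor_pred : {pred bilform -> R} :=
  [pred t | `[< exists s : seq (X * Z),
                  t = \sum_(p <- s) eval_tensor p.1 p.2 >] ].

Lemma tensor_predP t : reflect
  (exists s : seq (X * Z), t = \sum_(p <- s) eval_tensor p.1 p.2)
  (t \in tensor_pred).
Proof. exact: asboolP. Qed.

Lemma tensor_submod : submod_closed tensor_pred.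
Proof.
split; first by apply/tensor_predP; exists [::]; rewrite big_nil.
move=> a _ _ /tensor_predP[s ->] /tensor_predP[r ->]; apply/tensor_predP.
exists ([seq (a *: p.1, p.2) | p <- s] ++ r); rewrite big_cat big_map/=.
congr (_ + _); rewrite scaler_sumr; apply: eq_bigr => p _.
by apply/funext => B; rewrite /eval_tensor [RHS]linearZl_LR.
Qed.

HB.instance Definition _ := GRing.isSubmodClosed.Build R (bilform -> R)
  tensor_pred tensor_submod.

Record tensor := Tensor {
  tensor_val : bilform -> R; tensor_valP : tensor_val \in tensor_pred }.
HB.instance Definition _ := [isSub for tensor_val].
HB.instance Definition _ := [Choice of tensor by <:].
HB.instance Definition _ := [SubChoice_isSubLmodule of tensor by <:].

Lemma eval_tensor_in x z : eval_tensor x z \in tensor_pred.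
Proof. by apply/tensor_predP; exists [:: (x, z)]; rewrite big_seq1. Qed.

Definition tens x z := Tensor (eval_tensor_in x z).

Lemma tensor_rep (t : tensor) :
  exists s : seq (X * Z), t = \sum_(p <- s) tens p.1 p.2.
Proof.
have /tensor_predP[s ts] := tensor_valP t.
by exists s; apply: val_inj; rewrite raddf_sum; exact: ts.
Qed.

Lemma tensDl x x' z : tens (x + x') z = tens x z + tens x' z.
Proof.
by apply/val_inj/funext => B; rewrite /= /eval_tensor [LHS]linearDl.
Qed.

Lemma tensDr x z z' : tens x (z + z') = tens x z + tens x z'.
Proof.
by apply/val_inj/funext => B; rewrite /= /eval_tensor [LHS]linearDr.
Qed.

Lemma tensZl a x z : tens (a *: x) z = a *: tens x z.
Proof.
by apply/val_inj/funext => B; rewrite /= /eval_tensor [LHS]linearZl_LR.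
Qed.

Lemma tensZr a x z : tens x (a *: z) = a *: tens x z.
Proof.
by apply/val_inj/funext => B; rewrite /= /eval_tensor [LHS]linearZr_LR.
Qed.

End algebraic_tensor.

Section projective_tensor.
Context (R : realType) (X Z : normedModType R).
Implicit Types (s : seq (X * Z)) (t : tensor X Z).

Definition cost s : R := \sum_(p <- s) `|p.1| * `|p.2|.

(* The projective norm on the algebraic tensor product, over finite
   representations. On the completion, the norm is the infimum over all
   absolutely convergent series representations: see proj_normE. *)
Definition pi_norm t : R :=
  inf [set cost s | s in [set s | t = \sum_(p <- s) tens p.1 p.2]].

Lemma cost_ge0 s : 0 <= cost s.
Proof. by rewrite sumr_ge0// => p _; rewrite mulr_ge0. Qed.

Lemma pi_norm_le t s : t = \sum_(p <- s) tens p.1 p.2 -> pi_norm t <= cost s.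
Proof.
move=> ts; apply: ge_inf; last by exists s.
by exists 0 => _ [r _ <-]; exact: cost_ge0.
Qed.

Lemma pi_norm_adherent t (e : R) : 0 < e ->
  exists2 s, t = \sum_(p <- s) tens p.1 p.2 & cost s < pi_norm t + e.
Proof.
move=> e0; have [||_ [s ts <-] se] := @inf_adherent R
    [set cost s | s in [set s | t = \sum_(p <- s) tens p.1 p.2]] e => //.
  split; first by have [s ts] := tensor_rep t; exists (cost s), s.
  by exists 0 => _ [r _ <-]; exact: cost_ge0.
by exists s.
Qed.

Lemma pi_norm_ge0 t : 0 <= pi_norm t.
Proof.
apply/ler_addgt0Pr => e e0.
have [s _ /ltW] := pi_norm_adherent t e0.
exact/le_trans/cost_ge0.
Qed.

Lemma pi_normD t t' : pi_norm (t + t') <= pi_norm t + pi_norm t'.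
Proof.
apply/ler_addgt0Pr => e e0; have e2 : 0 < e / 2 by rewrite divr_gt0.
have [s ts sE] := pi_norm_adherent t e2.
have [r tr rE] := pi_norm_adherent t' e2.
apply: (@le_trans _ _ (cost (s ++ r))).
  by apply: pi_norm_le; rewrite big_cat/= -ts -tr.
by rewrite /cost big_cat/= [in leRHS](splitr e) addrACA lerD// ltW.
Qed.

Let pi_normZ_le (a : R) t : pi_norm (a *: t) <= `|a| * pi_norm t.
Proof.
apply/ler_addgt0Pr => e e0.
have a0 : 0 < `|a| + 1 by rewrite ltr_wpDl.
have [s ts sE] := pi_norm_adherent t (divr_gt0 e0 a0).
apply: (@le_trans _ _ (cost [seq (a *: p.1, p.2) | p <- s])).
  apply: pi_norm_le; rewrite big_map/= ts scaler_sumr.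
  by apply: eq_bigr => p _; rewrite tensZl.
rewrite /cost big_map/=.
have -> : \sum_(p <- s) `|a *: p.1| * `|p.2| = `|a| * cost s.
  by rewrite mulr_sumr; apply: eq_bigr => p _; rewrite normrZ mulrA.
apply: (@le_trans _ _ (`|a| * (pi_norm t + e / (`|a| + 1)))).
  by rewrite ler_wpM2l// ltW.
rewrite mulrDr lerD2l mulrCA ler_piMr ?ltW//.
by rewrite ltr_pdivrMr// mul1r ltrDl.
Qed.

Lemma pi_normZ (a : R) t : pi_norm (a *: t) = `|a| * pi_norm t.
Proof.
apply/eqP; rewrite eq_le pi_normZ_le/=.
have [->|a0] := eqVneq a 0; first by rewrite normr0 mul0r pi_norm_ge0.
rewrite -ler_pdivlMl ?normr_gt0// -normfV.
by have := pi_normZ_le a^-1 (a *: t); rewrite scalerA mulVf// scale1r.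
Qed.

Definition pi_seminorm : seminorm (tensor X Z) := Seminorm pi_normD pi_normZ.

Definition proj_tensor : Type := completion pi_seminorm.
HB.instance Definition _ := CompleteNormedModule.on proj_tensor.

Definition ptens (x : X) (z : Z) : proj_tensor :=
  to_completion pi_seminorm (tens x z).

Definition attains_proj_norm (t : proj_tensor) := exists (x : nat -> X)
  (z : nat -> Z), [/\ bounded_fun x, bounded_fun z,
    series (fun n => `|x n| * `|z n|) @ \oo --> `|t| &
    series (fun n => ptens (x n) (z n)) @ \oo --> t].

Lemma ptens_norm_le x z : `|ptens x z| <= `|x| * `|z|.
Proof.
rewrite to_completion_norm.
have := @pi_norm_le (tens x z) [:: (x, z)]; rewrite /cost !big_seq1.
exact.
Qed.

Lemma proj_norm_le_series (t : proj_tensor) (x : nat -> X) (z : nat -> Z) c :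
  series (fun n => `|x n| * `|z n|) @ \oo --> c ->
  series (fun n => ptens (x n) (z n)) @ \oo --> t -> `|t| <= c.
Proof.
move=> xzc xzt.
have nt : `|series (fun n => ptens (x n) (z n)) n| @[n --> \oo] --> `|t|.
  exact: cvg_norm.
apply: (ler_cvg_to nt xzc); apply: nearW => n.
rewrite (le_trans (ler_norm_sum _ _ _))//.
by apply: ler_sum => k _; exact: ptens_norm_le.
Qed.

Lemma proj_norm_series_adherent (t : proj_tensor) (e : R) : 0 < e ->
  exists (x : nat -> X) (z : nat -> Z) c,
    [/\ series (fun n => `|x n| * `|z n|) @ \oo --> c,
        series (fun n => ptens (x n) (z n)) @ \oo --> t & c <= `|t| + e].
Proof.
move=> e0; pose d k : R := e / 8 * 2^-1 ^+ k.
have d0 k : 0 < d k by rewrite mulr_gt0 ?divr_gt0// exprn_gt0// invr_gt0.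
have dS k : d k = d k.+1 + d k.+1.
  by rewrite /d exprSr mulrA -splitr.
have [w tw] := choice (fun k => completion_approx t (d0 k)).
pose v k := if k is k'.+1 then w k - w k' else w 0%N.
have vw k : \sum_(i < k.+1) v i = w k.
  elim: k => [|k ih]; first by rewrite big_ord1.
  by rewrite big_ord_recr/= ih addrC subrK.
have rep k : exists s, [/\ (0 < size s)%N, v k = \sum_(p <- s) tens p.1 p.2
    & cost s <= pi_norm (v k) + d k].
  have [s vs se] := pi_norm_adherent (v k) (d0 k); exists (rcons s (0, 0)).
  rewrite size_rcons /cost !big_rcons/= normr0 mul0r addr0.
  have -> : tens (0 : X) (0 : Z) = 0.
    by rewrite -[X in tens X _](scale0r (0 : X)) tensZl scale0r.
  by rewrite addr0 ltW.
have [s sP] := choice rep.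
pose L k := flatten [seq s i | i <- iota 0 k].
have LS k : L k.+1 = L k ++ s k.
  by rewrite /L -addn1 iotaD map_cat flatten_cat/= cats0.
have sizeL k : (k <= size (L k))%N.
  elim: k => // k ih; rewrite LS size_cat -addn1 leq_add//.
  by have [] := sP k.
pose g n := nth (0, 0) (L n.+1) n.
have Lle k m : (k <= m)%N -> exists r, L m = L k ++ r.
  move=> /subnK <-; elim: (m - k)%N => [|j [r ih]].
    by exists [::]; rewrite cats0.
  by exists (r ++ s (j + k)%N); rewrite addSn LS ih catA.
have gL k n : (n < size (L k))%N -> g n = nth (0, 0) (L k) n.
  move=> nk; rewrite /g; have [kn|/ltnW nk'] := leqP k n.+1.
    by have [r ->] := Lle _ _ kn; rewrite nth_cat nk.
  have [r ->] := Lle _ _ nk'; rewrite [RHS]nth_cat ifT//; exact: (sizeL n.+1).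
have sumL (V : zmodType) (h : X * Z -> V) k :
    series (h \o g) (size (L k)) = \sum_(p <- L k) h p.
  rewrite /series/= (big_nth (0, 0)) !big_mkord.
  by apply: eq_bigr => i _; rewrite (gL k).
have costL k : cost (L k) <= `|t| + e.
  rewrite (@le_trans _ _ (cost (L k.+1)))//.
    by rewrite LS /cost big_cat/= lerDl cost_ge0.
  suff : cost (L k.+1) <= `|t| + 8 * d 0%N - 6 * d k.
    have -> : 8 * d 0%N = e by rewrite /d expr0 mulr1 mulrC divfK.
    by move/le_trans; apply; rewrite gerBl mulr_ge0// ltW.
  have tn u : `|to_completion pi_seminorm u| = pi_norm u.
    exact: to_completion_norm.
  have nv0 : pi_norm (w 0%N) <= `|t| + d 0%N.
    rewrite -tn -lerBlDl ltW// (le_lt_trans _ (tw 0%N))//.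
    by rewrite -[leRHS]normrN opprB lerB_dist.
  elim: k => [|k ih].
    rewrite /L/= cats0; have [_ _] := sP 0%N; move=> /le_trans; apply.
    rewrite /=; lra.
  rewrite LS /cost big_cat/= -/(cost _) -/(cost (s _)).
  have [_ _ sk] := sP k.+1.
  have nv : pi_norm (v k.+1) <= d k + d k.+1.
    rewrite -tn raddfB/= -(subrK t (to_completion _ (w k.+1))).
    rewrite -addrA (le_trans (ler_normD _ _))// [leRHS]addrC lerD// ltW//.
    by rewrite distrC; exact: tw.
  have := dS k; have := d0 k.+1; lra.
pose x n := (g n).1; pose z n := (g n).2.
pose f p : R := `|p.1 : X| * `|p.2 : Z|.
have fseries : series (fun n => `|x n| * `|z n|) = series (f \o g) by [].
have nd : nondecreasing_seq (series (f \o g)).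
  by apply: nondecreasing_series => n _ _; rewrite mulr_ge0.
have ub n : series (f \o g) n <= `|t| + e.
  by rewrite (le_trans (nd _ _ (sizeL n)))// sumL; exact: costL.
have cf : cvgn (series (f \o g)).
  by apply: nondecreasing_is_cvgn => //; exists (`|t| + e) => _ [n _ <-].
exists x, z, (limn (series (f \o g))); split.
- by rewrite fseries.
- have cp : cvgn (series (fun n => ptens (x n) (z n))).
    apply: normed_cvg; apply: series_le_cvg cf.
    + by move=> n; exact: normr_ge0.
    + by move=> n; rewrite /f/= mulr_ge0.
    + by move=> n; exact: ptens_norm_le.
  suff -> : t = limn (series (fun n => ptens (x n) (z n))) by [].
  pose h p : proj_tensor := ptens p.1 p.2.
  have sz : size (L k.+1) @[k --> \oo] --> \oo.
    apply/cvgnyPge => N; exists N => // n /= Nn.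
    by rewrite (leq_trans Nn)// (leq_trans (leqnSn n))// sizeL.
  have c1 := cvg_comp (fun k => size (L k.+1)) _ sz cp.
  have wL k : series (h \o g) (size (L k.+1)) = to_completion pi_seminorm (w k).
    rewrite sumL -vw raddf_sum; elim: k => [|k ih].
      rewrite big_ord1 (_ : L 1%N = s 0%N); last exact: cats0.
      have [_ -> _] := sP 0%N.
      by rewrite raddf_sum.
    rewrite LS big_cat ih [RHS]big_ord_recr; congr (_ + _).
    by have [_ -> _] := sP k.+1; rewrite raddf_sum.
  have c2 : to_completion pi_seminorm (w k) @[k --> \oo] --> t.
    apply/cvgrPdist_lt => a a0.
    have : d @ \oo --> 0.
      rewrite -(mulr0 (e / 8)); apply: cvgM; first exact: cvg_cst.
      by apply: cvg_expr; rewrite ger0_norm ?invr_ge0// invf_lt1// ltr1n.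
    move=> /cvgrPdist_lt/(_ a a0)[N _ dN]; exists N => // n Nn /=.
    apply: lt_trans (tw n) _; have := dN n Nn.
    by rewrite sub0r normrN gtr0_norm.
  apply/esym/(@cvg_unique _ (@norm_hausdorff _ _) _ _ _ _ _ c2).
  by apply: cvg_trans c1; under eq_cvg do rewrite -wL.
- by apply: limr_le => //; apply: nearW.
Qed.

Lemma proj_normE (t : proj_tensor) :
  `|t| = inf [set c | exists (x : nat -> X) (z : nat -> Z),
    series (fun n => `|x n| * `|z n|) @ \oo --> c /\
    series (fun n => ptens (x n) (z n)) @ \oo --> t].
Proof.
apply/eqP; rewrite eq_le; apply/andP; split.
  apply: lb_le_inf.
    have [x [z [c [xc xt _]]]] := proj_norm_series_adherent t ltr01.
    by exists c, x, z.
  by move=> c [x [z [xc xt]]]; exact: proj_norm_le_series xc xt.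
apply/ler_addgt0Pr => e e0.
have [x [z [c [xc xt ce]]]] := proj_norm_series_adherent t e0.
apply: le_trans ce; apply: ge_inf; last by exists x, z.
exists `|t| => c' [x' [z' [xc' xt']]]; exact: proj_norm_le_series xc' xt'.
Qed.

End projective_tensor.

(* Main.v *)
From HB Require Import structures.
Require Import Defs.
From mathcomp Require Import all_boot all_order all_algebra.
From mathcomp Require Import all_classical all_reals.
From mathcomp Require Import ereal topology normedtype sequences.
From mathcomp Require Import exp.
From mathcomp Require Import zify ring lra.

Set Implicit Arguments.
Unset Strict Implicit.
Unset Printing Implicit Defensive.

Import Order.TTheory GRing.Theory Num.Theory.
Import numFieldNormedType.Exports.

Local Open Scope classical_set_scope.
Local Open Scope ring_scope.

(** Let [X] and [Y] be the same vector space of null sequences, with the sup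
    norm and with Read's norm. A norming functional [F] of a tensor that attains
    its norm is a bounded bilinear form [B] on [X] and the dual of [Y], with
    [B x0 f0 = |x0| |f0|] for some nonzero [x0] and [f0]. If [w] vanishes at the
    first coordinates and is small, then [x0 + w] and [x0 - w] are no longer
    than [x0], because the norm is a supremum of coordinates that tend to 0;
    hence [B (x0 + w)] and [B (x0 - w)] are norming at [f0] as well.

    Read's norm makes the bidual strictly convex, and this shows up as follows:
    two elements of the bidual that are norming at the same [f0] have
    proportional coordinates ([norming_minor]). Otherwise some finitely
    supported rational [u] is very positive on one and very negative on the
    other; [u] is one of the [u_n], and the summand
    [2 ^- (a_n ^ 2) |<x, u_n - e_(a_n)>|] of the norm separates the two. It
    follows that [w |-> B w] has rank at most one on a subspace of finite
    codimension ([rank_one_tail]), so that [B] has finite rank as far as the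
    coordinate functionals can see.

    So it is enough to find [z != 0] in the tensor product on which every form
    of finite rank vanishes. If [t] attains its norm and [F] norms [t], then
    [|t| = F (t - z) <= |t - z|], which keeps [t] out of the ball of centre [z]
    and radius [|z| / 2] ([not_dense_attaining]).

    Such a [z] is a tensor that represents the zero operator, and it exists
    because [X] fails the approximation property. Davie's construction gives
    vectors [e_(k,j)], [j < 2 ^ k], each supported on two consecutive blocks of
    coordinates, and two formulas for the coefficient of a vector along
    [e_(k,j)], one per block; [X] consists of the null sequences for which the
    formulas agree. The tensors [P_k], averages over [j] of [e_(k,j)] tensor
    its coefficient functional, have trace 1, so their norms stay away from 0
    ([davie_tensor_norm]). Read on the block common to levels [k] and [k + 1],
    the difference [P_(k+1) - P_k] is an average of elementary tensors whose
    left factors are uniformly small ([davie_diff_norm]), by the square root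
    cancellation of suitably chosen signs ([davie_exists]). So [P_k] converges
    to some [z != 0], while a form of rank one sends [P_k] to a quantity of
    order [2 ^ (- k / 2)] by Bessel's inequality ([coef_mean_small]). *)

(** * Choosing signs with small discrepancy *)

Lemma expR_le_1D (R : realType) (x : R) :
  - 2^-1 <= x -> expR (x - 2 * x ^+ 2) <= 1 + x.
Proof.
move=> x2; have x1 : 0 < 1 + x by lra.
rewrite -[leRHS]invrK -[x - _]opprB expRN lef_pV2 ?posrE ?invr_gt0 ?expR_gt0//.
apply: le_trans (expR_ge1Dx _).
rewrite -[leLHS]mul1r ler_pdivrMr//.
nra.
Qed.

(** The sum over [C] of the products is a martingale for uniform independent
    choices, because [v i m c] has mean 0 over [m]. Choosing at each step an [m]
    for which the sum is at most its mean replaces the probability space. *)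
Lemma balanced_choice (R : realType) (C M : finType) (m0 : M) (n : nat)
    (v : nat -> M -> C -> R) (lam : R) :
  (forall i m c, `|v i m c| <= 1) -> (forall i c, \sum_m v i m c = 0) ->
  0 <= lam <= 2^-1 ->
  exists f : nat -> M,
    \sum_c \prod_(i < n) (1 + lam * v i (f i) c) <= #|C|%:R.
Proof.
move=> v1 v0 /andP[l0 l2]; elim: n => [|n [f ih]].
  exists (fun=> m0); under eq_bigr do rewrite big_ord0.
  by rewrite sumr_const.
pose W m : R := \sum_c (\prod_(i < n) (1 + lam * v i (f i) c)) *
                     (1 + lam * v n m c).
have sW : \sum_m W m = #|M|%:R * \sum_c \prod_(i < n) (1 + lam * v i (f i) c).
  rewrite exchange_big mulr_sumr; apply: eq_bigr => c _ /=.
  rewrite -mulr_sumr big_split/= sumr_const -mulr_sumr v0 mulr0 addr0.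
  by rewrite mulrC.
have [m mW] : exists m, W m <= #|C|%:R.
  apply: contrapT => /forallNP nW.
  have : \sum_(m : M) (#|C|%:R : R) < \sum_m W m.
    apply: ltr_sum; first by apply/hasP; exists m0; rewrite ?mem_index_enum.
    by move=> m _; rewrite ltNge; apply/negP/nW.
  rewrite sW sumr_const -[X in X < _]mulr_natl ltNge ler_wpM2l//.
pose f' i := if i == n then m else f i.
exists f'; rewrite (le_trans _ mW)// /W.
apply: ler_sum => c _; rewrite big_ord_recr /= /f' eqxx.
rewrite le_eqVlt; apply/orP; left; apply/eqP; congr (_ * _).
by apply: eq_bigr => i _; rewrite ltn_eqF.
Qed.

(** The factor [1 + x] is at least [expR (x - 2 x ^ 2)], so the bound on the
    products controls [lam S - 2 lam ^ 2 n]. The parameter [lam] is left free: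
    optimizing it would give Hoeffding's inequality up to a constant. *)
Lemma small_discrepancy (R : realType) (C M : finType) (m0 : M) (n b : nat)
    (v : nat -> M -> C -> R) (lam : R) :
  (forall i m c, `|v i m c| <= 1) -> (forall i c, \sum_m v i m c = 0) ->
  0 < lam <= 2^-1 -> (#|C| <= 2 ^ b)%N ->
  exists f : nat -> M, forall c,
    \sum_(i < n) v i (f i) c <= 2 * lam * n%:R + b%:R / lam.
Proof.
move=> v1 v0 /andP[l0 l2] Cb.
have [|f fC] := @balanced_choice R C M m0 n v lam v1 v0; first by rewrite ltW.
exists f => c; set S := \sum_(i < n) _.
have lv i m : `|lam * v i m c| <= 2^-1.
  by rewrite normrM gtr0_norm// (le_trans _ l2)// ler_piMr// ltW.
have pos i m c' : 0 <= 1 + lam * v i m c'.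
  have : - 1 <= v i m c' by have := v1 i m c'; rewrite ler_norml => /andP[].
  move=> h; have : - lam <= lam * v i m c' by rewrite -mulrN1 ler_pM2l.
  lra.
have h1 : expR (lam * S - 2 * lam ^+ 2 * n%:R) <= expR b%:R.
  apply: (@le_trans _ _ (\prod_(i < n) (1 + lam * v i (f i) c))).
    have -> : lam * S - 2 * lam ^+ 2 * n%:R =
        \sum_(i < n) (lam * v i (f i) c - 2 * lam ^+ 2).
      by rewrite sumrB -mulr_sumr sumr_const card_ord mulr_natr.
    rewrite expR_sum; apply: ler_prod => i _; rewrite expR_ge0/=.
    apply: le_trans (expR_le_1D _); last first.
      by have := lv i (f i); rewrite ler_norml => /andP[].
    rewrite ler_expR lerD2l lerN2 ler_pM2l// exprMn ler_piMr ?sqr_ge0//.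
    by rewrite -real_normK ?num_real// expr_le1.
  apply: (@le_trans _ _ #|C|%:R).
    apply: le_trans fC; rewrite (bigD1 c)//= lerDl.
    by apply: sumr_ge0 => c' _; apply: prodr_ge0 => i _.
  apply: (@le_trans _ _ (2 ^+ b)); first by rewrite -natrX ler_nat.
  rewrite -[b%:R]mulr1 expRM_natl lerXn2r ?nnegrE ?expR_ge0//.
  by apply: le_trans (expR_ge1Dx _); rewrite -natr1.
rewrite ler_expR in h1.
rewrite -(ler_pM2l l0); have -> : lam * (2 * lam * n%:R + b%:R / lam) =
  2 * lam ^+ 2 * n%:R + b%:R by field; rewrite gt_eqF.
lra.
Qed.

(** * Davie's systems of signs *)

Lemma sum_double (V : nmodType) (n : nat) (f : nat -> V) :
  \sum_(j < n.*2) f j = \sum_(i < n) (f i.*2 + f i.*2.+1).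
Proof.
elim: n => [|n ih]; first by rewrite !big_ord0.
by rewrite doubleS !big_ord_recr/= ih addrA.
Qed.

Section davie.
Variable R : realType.

(** The Sylvester Hadamard matrix: the parity of the number of common binary
    digits of [i] and [g] among the first [m]. *)
Fixpoint walsh (m i g : nat) : R :=
  if m is m'.+1 then (-1) ^+ (odd i && odd g) * walsh m' i./2 g./2 else 1.

Lemma walsh_sqr m i g : walsh m i g ^+ 2 = 1.
Proof.
elim: m i g => [|m ih] i g /=; first by rewrite expr1n.
by rewrite exprMn ih mulr1 sqrr_sign.
Qed.

Lemma walsh_norm m i g : `|walsh m i g| = 1.
Proof.
by apply/eqP; rewrite -(@eqrXn2 _ 2)// expr1n real_normK ?num_real// walsh_sqr.
Qed.

Lemma walsh_orth m i j : (i < 2 ^ m)%N -> (j < 2 ^ m)%N ->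
  \sum_(g < 2 ^ m) walsh m i g * walsh m j g = 2 ^+ m * (i == j)%:R.
Proof.
elim: m i j => [|m ih] i j.
  by rewrite !ltnS !leqn0 => /eqP-> /eqP->; rewrite big_ord1 /= !mulr1.
move=> im jm; rewrite expnS mul2n.
rewrite (sum_double _ (fun g => walsh m.+1 i g * walsh m.+1 j g)) /=.
pose c : R := 1 + (-1) ^+ odd i * (-1) ^+ odd j.
rewrite (eq_bigr (fun g : 'I__ => c * (walsh m i./2 g * walsh m j./2 g))).
  rewrite -mulr_sumr ih; [|by rewrite expnS in im; lia|by rewrite expnS in jm; lia].
  rewrite /c -signr_addb exprS.
  have -> : (i == j) = (odd i == odd j) && (i./2 == j./2).
    by apply/eqP/andP => [->//|[/eqP oij /eqP hij]]; lia.
  case: (i./2 == j./2); last by rewrite andbF !mulr0.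
  rewrite andbT !mulr1 mulrC; case: (odd i); case: (odd j);
    rewrite /= ?expr0 ?expr1; ring.
move=> g _; rewrite odd_double !andbF !andbT doubleK expr0 !mul1r /c.
by rewrite uphalf_double; ring.
Qed.

(** A summable rate that dominates, relative to [2 ^ k] terms, the discrepancy
    for [4 ^ (k + 2)] pairs of points, with [lam = (2 / 3) ^ k / 2] in
    [small_discrepancy]. *)
Definition davie_bound k : R := 49 * (27 / 32) ^+ k.

(** Block [k] of the coordinates has [2 ^ (k + 1)] points. It carries the functions
    [ds_t k j], [j < 2 ^ k], and, for [k > 0], the functions [ds_s (k - 1) j],
    [j < 2 ^ (k - 1)]; together they are orthogonal. The vector of index [(k, j)]
    is [ds_t k j] on block [k] followed by [ds_s k j] on block [k + 1]. The last
    two conditions are the cancellations behind [davie_diff_norm]: [ds_gram] says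
    that the normalized kernels of the two projections living on one block are
    close, [ds_mix] that vectors of the same level decorrelate between blocks. *)
Record davie_system := DavieSystem {
  ds_s : nat -> nat -> nat -> R;
  ds_t : nat -> nat -> nat -> R;
  ds_s_le1 : forall k j g, `|ds_s k j g| <= 1;
  ds_t_le1 : forall k j g, `|ds_t k j g| <= 1;
  ds_s_orth : forall k i j, (i < 2 ^ k)%N -> (j < 2 ^ k)%N ->
    \sum_(g < 2 ^ k.+2) ds_s k i g * ds_s k j g = 2 ^+ k.+2 * (i == j)%:R;
  ds_t_orth : forall k i j, (i < 2 ^ k)%N -> (j < 2 ^ k)%N ->
    \sum_(g < 2 ^ k.+1) ds_t k i g * ds_t k j g = 2 ^+ k.+1 * (i == j)%:R;
  ds_st_orth : forall k i j, (i < 2 ^ k)%N -> (j < 2 ^ k.+1)%N ->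
    \sum_(g < 2 ^ k.+2) ds_s k i g * ds_t k.+1 j g = 0;
  ds_gram : forall k g h, (g < 2 ^ k.+2)%N -> (h < 2 ^ k.+2)%N ->
    `|\sum_(j < 2 ^ k.+1) ds_t k.+1 j g * ds_t k.+1 j h
      - 2 * \sum_(j < 2 ^ k) ds_s k j g * ds_s k j h|
      <= 4 * (2 ^+ k * davie_bound k);
  ds_mix : forall k g h, (g < 2 ^ k.+1)%N -> (h < 2 ^ k.+2)%N ->
    `|\sum_(j < 2 ^ k) ds_t k j g * ds_s k j h| <= 2 ^+ k * davie_bound k
}.

Lemma davie_boundP k (lam := 2^-1 * (2 / 3) ^+ k : R) :
  2 * lam * (2 ^ k)%:R + (2 * k + 5)%:R / lam <= 2 ^+ k * davie_bound k.
Proof.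
have bern : 1 + k%:R / 8 <= (9 / 8) ^+ k :> R.
  elim: k {lam} => [|k ih]; first by rewrite expr0 mul0r addr0.
  rewrite exprS -natr1.
  have : 0 <= k%:R :> R by []; nra.
have e1 : 2 * lam * (2 ^ k)%:R = 2 ^+ k * (2 / 3) ^+ k.
  by rewrite natrX /lam mulrA divff// mul1r mulrC.
have e2 : (2 * k + 5)%:R / lam = 2 ^+ k * (2 * (2 * k%:R + 5) * (3 / 4) ^+ k).
  have -> : lam^-1 = 2 * (2 * (3 / 4)) ^+ k.
    rewrite /lam invfM invrK -exprVn invf_div; by congr (_ * _ ^+ _); field.
  by rewrite exprMn natrD natrM; ring.
rewrite e1 e2 -mulrDr ler_pM2l ?exprn_gt0// /davie_bound.
have -> : 49 = 1 + 48 :> R by ring.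
rewrite [leRHS]mulrDl mul1r lerD//.
  by rewrite lerXn2r ?nnegrE//; lra.
have -> : (27 / 32 : R) ^+ k = (9 / 8) ^+ k * (3 / 4) ^+ k.
  by rewrite -exprMn; congr (_ ^+ _); field.
rewrite mulrA ler_pM2r ?exprn_gt0//.
have : 0 <= k%:R :> R by [].
lra.
Qed.

(** Two-sided form of [small_discrepancy]: the constraints are pairs of points
    together with a sign. *)
Lemma davie_choice k (M : finType) (m0 : M) (v : nat -> M -> nat -> nat -> R) :
  (forall i m g h, `|v i m g h| <= 1) ->
  (forall i g h, \sum_m v i m g h = 0) ->
  exists f : nat -> M, forall g h, (g < 2 ^ k.+2)%N -> (h < 2 ^ k.+2)%N ->
    `|\sum_(i < 2 ^ k) v i (f i) g h| <= 2 ^+ k * davie_bound k.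
Proof.
move=> v1 v0; pose lam : R := 2^-1 * (2 / 3) ^+ k.
pose C : finType := ('I_(2 ^ k.+2) * 'I_(2 ^ k.+2) * bool)%type.
pose w i m (c : C) : R := (-1) ^+ c.2 * v i m c.1.1 c.1.2.
have [| | | |f fP] := @small_discrepancy R C M m0 (2 ^ k) (2 * k + 5) w lam.
- by move=> i m c; rewrite normrM normr_sign mul1r.
- by move=> i c; rewrite -mulr_sumr v0 mulr0.
- rewrite mulr_gt0 ?exprn_gt0//= ler_piMr// exprn_ile1//; lra.
- by rewrite /C !card_prod !card_ord card_bool -expnD -expnSr leq_exp2l//; lia.
exists f => g h gk hk.
have bnd (b : bool) :
    (-1) ^+ b * \sum_(i < 2 ^ k) v i (f i) g h <= 2 ^+ k * davie_bound k.
  apply: le_trans (davie_boundP k).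
  have := fP (Ordinal gk, Ordinal hk, b).
  by rewrite -mulr_sumr.
rewrite ler_norml -lerNl.
by have := bnd true; have := bnd false; rewrite expr1 expr0 mul1r mulN1r => -> ->.
Qed.

(** The [2 ^ (k + 2)] Walsh functions on block [k + 1] are grouped by four. In each
    group, a cyclic shift decides which one becomes [s k i] and which two become
    [t k.+1 (2 i)] and [t k.+1 (2 i + 1)]; the weights 2, -1, -1, 0 have mean 0
    over the four shifts, which gives the Gram condition. Signs on the functions
    [s k i], which affect neither orthogonality nor the Gram condition, give the
    mixing condition. *)
Lemma davie_exists : inhabited davie_system.
Proof.
(* c i is the shift of the i-th group; q is the position after the shift. *)
pose W k (c : nat -> 'I_4) i q := walsh k.+2 (4 * i + (c i + q) %% 4).
have Wn k c i q g : `|W k c i q g| = 1 by exact: walsh_norm.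
have row_lt k i q : (i < 2 ^ k)%N -> (4 * i + q %% 4 < 2 ^ k.+2)%N.
  by move=> ik; rewrite !expnS; lia.
have gramP k : exists c : nat -> 'I_4, forall g h,
    (g < 2 ^ k.+2)%N -> (h < 2 ^ k.+2)%N ->
    `|\sum_(i < 2 ^ k) (W k c i 1 g * W k c i 1 h + W k c i 2 g * W k c i 2 h
      - 2 * (W k c i 0 g * W k c i 0 h))|
      <= 4 * (2 ^+ k * davie_bound k).
  pose X i q g h :=
    walsh k.+2 (4 * i + q %% 4) g * walsh k.+2 (4 * i + q %% 4) h.
  pose v i (q : 'I_4) g h : R :=
    (X i (q + 1)%N g h + X i (q + 2)%N g h - 2 * X i q g h) / 4.
  have [| |c cP] := @davie_choice k _ ord0 v.
  - move=> i q g h.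
    have X1 q' : `|X i q' g h| <= 1 by rewrite normrM !walsh_norm mulr1.
    have := X1 (q + 1)%N; have := X1 (q + 2)%N; have := X1 q.
    rewrite /v !ler_norml => /andP[? ?] /andP[? ?] /andP[? ?].
    by apply/andP; split; lra.
  - move=> i g h; rewrite /v !big_ord_recl big_ord0 /= /bump /= /X /=; ring.
  exists c => g h gk hk.
  have -> : \sum_(i < 2 ^ k) (W k c i 1 g * W k c i 1 h + W k c i 2 g * W k c i 2 h
      - 2 * (W k c i 0 g * W k c i 0 h)) = 4 * \sum_(i < 2 ^ k) v i (c i) g h.
    by rewrite mulr_sumr; apply: eq_bigr => i _; rewrite /v /W /X addn0; field.
  by rewrite normrM ger0_norm// ler_pM2l// cP.
have [c cP] := choice gramP.
pose t k j := if k is k'.+1 then W k' (c k') j./2 (1 + odd j)%N else fun=> 1.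
have tn k j g : `|t k j g| = 1 by case: k => [|k]; [exact: normr1|exact: Wn].
have mixP k : exists eps : nat -> bool, forall g h,
    (g < 2 ^ k.+2)%N -> (h < 2 ^ k.+2)%N ->
    `|\sum_(j < 2 ^ k) t k j g * ((-1) ^+ eps j * W k (c k) j 0 h)|
      <= 2 ^+ k * davie_bound k.
  have [| |eps eP] := @davie_choice k bool true
      (fun j b g h => t k j g * ((-1) ^+ b * W k (c k) j 0 h)).
  - by move=> i b g h; rewrite normrM tn mul1r normrM normr_sign mul1r Wn.
  - move=> i g h; rewrite big_bool [_ ^+ true]expr1 [_ ^+ false]expr0.
    by rewrite mulN1r mul1r mulrN; exact: addNr.
  by exists eps.
have [eps eP] := choice mixP.
pose s k j g := (-1) ^+ eps k j * W k (c k) j 0 g.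
have Worth k i i' q q' : (i < 2 ^ k)%N -> (i' < 2 ^ k)%N ->
    \sum_(g < 2 ^ k.+2) W k (c k) i q g * W k (c k) i' q' g =
    2 ^+ k.+2 * ((i == i') && ((c k i + q) %% 4 == (c k i' + q') %% 4)%N)%:R.
  move=> ik ik'; rewrite walsh_orth ?row_lt//.
  congr (_ * (nat_of_bool _)%:R).
  by apply/eqP/andP => [|[/eqP-> /eqP->]//]; lia.
split; refine (@DavieSystem s t _ _ _ _ _ _ _).
- by move=> k j g; rewrite /s normrM normr_sign Wn mulr1.
- by move=> k j g; rewrite tn.
- move=> k i j ik jk.
  under eq_bigr do rewrite /s mulrACA -signr_addb.
  rewrite -mulr_sumr Worth//.
  have [->|ij] := eqVneq i j; last by rewrite !mulr0.
  by rewrite addbb expr0 mul1r eqxx.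
- case=> [|k] i j.
    rewrite !ltnS !leqn0 => /eqP-> /eqP->.
    by under eq_bigr do rewrite /= mulr1; rewrite sumr_const card_ord mulr1 expr1.
  rewrite expnS => ik jk; rewrite Worth; [|lia..].
  congr (_ * (nat_of_bool _)%:R).
  apply/andP/eqP => [[/eqP e1]|->//]; rewrite e1 => /eqP.
  move: (odd_double_half i) (odd_double_half j); rewrite e1.
  by case: (odd i); case: (odd j) => /=; lia.
- move=> k i j ik; rewrite expnS => jk.
  under eq_bigr do rewrite /s -mulrA.
  rewrite -mulr_sumr Worth; [|lia..].
  case: eqP => [e1|]; last by rewrite !mulr0.
  rewrite -e1; case: eqP => [|_]; last by rewrite !mulr0.
  by case: (odd j) => /=; lia.
- move=> k g h gk hk.
  rewrite expnS mul2n.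
  rewrite (sum_double _ (fun j => t k.+1 j g * t k.+1 j h)).
  rewrite mulr_sumr -sumrB.
  apply: le_trans (cP k g h gk hk); rewrite le_eqVlt; apply/orP; left.
  apply/eqP; congr `|_|; apply: eq_bigr => i _.
  have ss : s k i g * s k i h = W k (c k) i 0 g * W k (c k) i 0 h.
    by rewrite /s mulrACA -signr_addb addbb expr0 mul1r.
  have t0 x : t k.+1 i.*2 x = W k (c k) i 1 x by rewrite /t doubleK odd_double.
  have t1 x : t k.+1 i.*2.+1 x = W k (c k) i 2 x.
    by rewrite /t [_./2]uphalf_double oddS odd_double.
  by rewrite ss !t0 !t1.
- by move=> k g h gk hk; apply: eP => //; rewrite expnS; lia.
Qed.

End davie.

(** * The Hahn-Banach theorem *)

Lemma linear_formP (R : realType) (V : lmodType R) (phi : V -> R) : linear phi ->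
  [/\ phi 0 = 0, forall a x, phi (a *: x) = a * phi x &
      forall x y, phi (x + y) = phi x + phi y].
Proof.
move=> lp; have phi0 : phi 0 = 0.
  by apply: (addrI (phi 0)); have := lp 1 0 0; rewrite !scale1r !addr0.
split=> // [a x|x y]; first by rewrite -[a *: x]addr0 lp phi0 addr0.
by have := lp 1 x y; rewrite !scale1r.
Qed.

Section hahn_banach.
Context (R : realType) (V : lmodType R).
Implicit Types (p : V -> R) (x y v : V).

Definition sublinear p := (forall x y, p (x + y) <= p x + p y) /\
  (forall (a : R) x, 0 < a -> p (a *: x) <= a * p x).

Lemma sublinear0 p : sublinear p -> p 0 = 0.
Proof.
move=> [pD pZ]; apply/eqP; rewrite eq_le.
have := pZ 2^-1 0 ltac:(by rewrite invr_gt0); have := pD 0 0.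
rewrite addr0 scaler0 => ? ?; apply/andP; split; lra.
Qed.

Lemma sublinearZ p (a : R) x : sublinear p -> 0 <= a -> p (a *: x) = a * p x.
Proof.
move=> sp; rewrite le_eqVlt => /predU1P[<-|a0].
  by rewrite scale0r mul0r sublinear0.
have [_ pZ] := sp; apply/eqP; rewrite eq_le pZ//=.
have := pZ a^-1 (a *: x) ltac:(by rewrite invr_gt0).
by rewrite scalerA mulVf ?gt_eqF// scale1r ler_pdivlMl.
Qed.

Lemma sublinear_oppr p x : sublinear p -> - p (- x) <= p x.
Proof.
move=> sp; have [pD _] := sp.
by have := pD x (- x); rewrite subrr sublinear0//; lra.
Qed.

(** The largest sublinear functional below [p] whose value at [- v] is at most
    [- p v]. A sublinear functional is linear as soon as no [slide] lowers it. *)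
Definition slide p v x := inf [set p (x + t *: v) - t * p v | t in [set t | 0 <= t]].

Lemma slide_le p v x t : sublinear p -> 0 <= t ->
  slide p v x <= p (x + t *: v) - t * p v.
Proof.
move=> sp t0; apply: ge_inf; last by exists t.
exists (- p (- x)) => _ [u u0 <-]; have [pD _] := sp.
have := pD (x + u *: v) (- x).
by rewrite addrAC subrr add0r sublinearZ//; lra.
Qed.

Lemma slide_adherent p v x e : sublinear p -> 0 < e ->
  exists2 t, 0 <= t & p (x + t *: v) - t * p v < slide p v x + e.
Proof.
move=> sp e0; have [||_ [t t0 <-] te] := @inf_adherent R
  [set p (x + t *: v) - t * p v | t in [set t | 0 <= t]] e => //; last by exists t.
split; first by exists (p (x + 0 *: v) - 0 * p v), 0 => //=.
exists (- p (- x)) => _ [u u0 <-]; have [pD _] := sp.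
have := pD (x + u *: v) (- x).
by rewrite addrAC subrr add0r sublinearZ//; lra.
Qed.

Lemma slide_sublinear p v : sublinear p -> sublinear (slide p v).
Proof.
move=> sp; have [pD pZ] := sp; split.
  move=> x y; apply/ler_addgt0Pr => e e0.
  have e2 : 0 < e / 2 by rewrite divr_gt0.
  have [t t0 te] := slide_adherent v x sp e2.
  have [u u0 ue] := slide_adherent v y sp e2.
  have := slide_le v (x + y) sp (addr_ge0 t0 u0).
  have := pD (x + t *: v) (y + u *: v).
  by rewrite addrACA -scalerDl; lra.
move=> a x a0; apply/ler_addgt0Pr => e e0.
have [t t0 te] := slide_adherent v x sp (divr_gt0 e0 a0).
have := slide_le v (a *: x) sp (mulr_ge0 (ltW a0) t0).
rewrite -scalerA -scalerDr (sublinearZ _ sp (ltW a0)) -mulrA -mulrBr.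
move=> /le_trans; apply; rewrite -(ler_pM2l (_ : 0 < a^-1)) ?invr_gt0//.
rewrite mulKf ?gt_eqF// mulrDr mulKf ?gt_eqF// ltW// (lt_le_trans te)//.
by rewrite lerD2l mulrC.
Qed.

(** Zorn's lemma for the pointwise order; along a chain, the infimum is again
    sublinear, and is finite because [q x >= - q (- x) >= - p (- x)]. *)
Lemma minimal_sublinear p : sublinear p ->
  exists2 q, sublinear q /\ (forall x, q x <= p x) &
    forall r, sublinear r -> (forall x, r x <= q x) -> forall x, q x <= r x.
Proof.
move=> sp; pose T := {q : V -> R | sublinear q /\ forall x, q x <= p x}.
pose t0 : T := exist _ p (conj sp (fun x => lexx (p x))).
pose leT (q r : T) := `[< forall x, sval r x <= sval q x >].
have [||A totA|q qP] := @ZL_preorder T t0 leT.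
- by move=> q; apply/asboolP.
- move=> r s t /asboolP rs /asboolP st; apply/asboolP => x.
  exact: le_trans (st x) (rs x).
- have [[q0 Aq0]|] := pselect (A !=set0); last first.
    by move=> A0; exists t0 => q Aq; exfalso; apply: A0; exists q.
  pose m x := inf [set sval q x | q in A].
  have lbm x : has_lbound [set sval q x | q in A].
    exists (- p (- x)) => _ [[q [sq qp]] Aq <-] /=.
    by apply: le_trans (sublinear_oppr x sq); rewrite lerN2.
  have mle x q : A q -> m x <= sval q x by move=> Aq; apply: ge_inf => //; exists q.
  have mge x c : (forall q, A q -> c <= sval q x) -> c <= m x.
    move=> h; apply: lb_le_inf; first by exists (sval q0 x), q0.
    by move=> _ [q Aq <-]; exact: h.
  have sm : sublinear m.
    split=> [x y|a x a0].
      rewrite -lerBlDr; apply/mge => q Aq; rewrite lerBlDr -lerBlDl.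
      apply/mge => r Ar; rewrite lerBlDl.
      have [/asboolP qr|/asboolP rq] := totA _ _ Aq Ar.
        apply: le_trans (mle _ _ Ar) _; have [[rD _] _] := svalP r.
        by rewrite (le_trans (rD _ _))// lerD2r.
      apply: le_trans (mle _ _ Aq) _; have [[qD _] _] := svalP q.
      by rewrite (le_trans (qD _ _))// lerD2l.
    rewrite -ler_pdivrMl//; apply/mge => q Aq; rewrite ler_pdivrMl//.
    by apply: le_trans (mle _ _ Aq) _; have [[_ qZ] _] := svalP q; exact: qZ.
  have mp : forall x, m x <= p x.
    by move=> x; apply: le_trans (mle x _ Aq0) _; have [_] := svalP q0.
  exists (exist _ m (conj sm mp)) => q Aq; apply/asboolP => x /=; exact: mle.
exists (sval q); first exact: (svalP q).
move=> r sr rq.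
have rp x : r x <= p x by apply: le_trans (rq x) _; have [_] := svalP q.
by have /asboolP := qP (exist _ r (conj sr rp)) ltac:(exact/asboolP).
Qed.

(** A minimal sublinear functional below [slide p v]: being minimal, it is fixed
    by all slides, hence odd, hence linear; starting from [slide p v] forces the
    value [p v] at [v]. *)
Lemma hahn_banach p v : sublinear p ->
  exists2 f : V -> R, linear f & f v = p v /\ forall x, f x <= p x.
Proof.
move=> sp; have [f [sf fp] fmin] := minimal_sublinear (slide_sublinear v sp).
have fN x : f (- x) = - f x.
  apply/eqP; rewrite eq_le; apply/andP; split; last first.
    by have := sublinear_oppr (- x) sf; rewrite opprK.
  apply: le_trans (fmin _ (slide_sublinear x sf) _ (- x)) _.
    by move=> y; have := slide_le x y sf (lexx 0); rewrite scale0r addr0 mul0r subr0.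
  have := slide_le x (- x) sf ler01.
  by rewrite scale1r addNr sublinear0// mul1r sub0r.
have fD x y : f (x + y) = f x + f y.
  have [fD _] := sf; apply/eqP; rewrite eq_le fD/=.
  by have := fD (x + y) (- y); rewrite addrK fN lerBrDr.
have fZ (a : R) x : f (a *: x) = a * f x.
  have [a0|a0] := leP 0 a; first exact: sublinearZ.
  rewrite -[a]opprK scaleNr fN sublinearZ//; last by rewrite oppr_ge0 ltW.
  by rewrite [RHS]mulNr.
have fp' x : f x <= p x.
  apply: le_trans (fp x) _; have := slide_le v x sp (lexx 0).
  by rewrite scale0r addr0 mul0r subr0.
exists f; first by move=> a x y; rewrite fD fZ.
split=> //; apply/eqP; rewrite eq_le fp'/= -lerN2 -fN.
apply: le_trans (fp _) _; have := slide_le v (- v) sp ler01.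
by rewrite scale1r addNr sublinear0// mul1r sub0r.
Qed.

End hahn_banach.

(** * Functionals norming a point of a dual space *)

Section dual_theory.
Context (R : realType) (V : normedModType R).

Lemma dual_ext (f g : dual V) : (forall x, f x = g x) -> f = g.
Proof. by move=> fg; apply/val_inj/funext. Qed.

Lemma dual_sumE I (r : seq I) (f : I -> dual V) x :
  (\sum_(i <- r) f i : dual V) x = \sum_(i <- r) f i x.
Proof. exact: (big_morph (fun f : dual V => f x)). Qed.

Lemma csub_val_lin (S : csubspace V) : linear (@csub_val R V S).
Proof. by []. Qed.

Lemma dual_le (f : dual V) x : `|f x| <= `|f| * `|x|.
Proof.
have [->|x0] := eqVneq x 0.
  have -> : f 0 = 0 := linear0 (dual_linfun f).
  by rewrite !normr0 mulr0.
have nx : 0 < `|x| by rewrite normr_gt0.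
have : `|f (`|x|^-1 *: x)| <= `|f|.
  apply: sup_norm_le; first exact: dual_bounded.
  by rewrite /unit_ball/= normrZ normfV normr_id mulVf ?gt_eqF.
have -> : f (`|x|^-1 *: x) = `|x|^-1 * f x := linearZZ (dual_linfun f) _ x.
by rewrite normrM normfV normr_id ler_pdivrMl// mulrC.
Qed.

Lemma dual_norm_le (f : dual V) (c : R) : 0 <= c ->
  (forall x, `|f x| <= c * `|x|) -> `|f| <= c.
Proof.
move=> c0 fc; apply: sup_norm_ub; first exact: unit_ball0.
by move=> x x1; rewrite (le_trans (fc x))// ler_piMr.
Qed.

Lemma dual_pred_bounded (f : V -> R) (c : R) : linear f ->
  (forall x, `|f x| <= c * `|x|) -> f \in @dual_pred R V.
Proof.
move=> lf fc; apply/dual_predP; split=> // x.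
apply/cvgrPdist_lt => e e0.
have c0 : 0 < `|c| + 1 by rewrite ltr_wpDl.
near=> y.
have -> : f x - f y = f (x - y).
  by rewrite -[- y]scaleN1r [x + _]addrC lf scaleN1r addrC.
apply: (@le_lt_trans _ _ ((`|c| + 1) * `|x - y|)).
  apply: le_trans (fc _) _; rewrite ler_wpM2r//.
  by rewrite (le_trans (ler_norm _))// lerDl.
rewrite -ltr_pdivlMl// mulrC; near: y.
by apply: cvgr_dist_lt => //; rewrite divr_gt0.
Unshelve. all: by end_near. Qed.

(** The functional [f0] is dominated by [|f0|] times the sum of the seminorms
    [q] and [w |g|], so it splits into a part below the first and a multiple of
    [g]. The scalar [s] is the slope of a linear minorant of the sublinear
    function [t |-> inf_x (|f0| q x + |f0| w |t + g x| - f0 x)] of one real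
    variable, for which the value at [1] can be taken. *)
Lemma dual_split (f0 g : dual V) (w : R) (q := fun x => `|x| - w * `|g x|) :
  0 < w -> (forall x y, q (x + y) <= q x + q y) ->
  exists s, forall x, f0 x - s * g x <= `|f0| * q x.
Proof.
move=> w0 qD; pose nu := `|f0|; have nu0 : 0 <= nu by exact: normr_ge0.
have fD (f : dual V) x y : f (x + y) = f x + f y := raddfD (dual_linfun f) x y.
have fZ (f : dual V) a x : f (a *: x) = a * f x := linearZZ (dual_linfun f) a x.
have qZ a x : q (a *: x) = `|a| * q x.
  by rewrite /q normrZ fZ normrM; ring.
have f0q x : f0 x <= nu * q x + nu * w * `|g x|.
  have -> : nu * q x + nu * w * `|g x| = nu * `|x| by rewrite /q; ring.
  exact: le_trans (ler_norm _) (dual_le _ _).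
pose P x := nu * q x + nu * w * `|1 + g x| - f0 x.
have Plb x y : g y = 1 -> f0 y - nu * q y <= P x.
  move=> gy; have := f0q (x + y); rewrite !fD gy /P [g x + 1]addrC.
  by have := ler_wpM2l nu0 (qD x y); rewrite mulrDr; lra.
have lbP : has_lbound (range P).
  exists (- (nu * w)) => _ [x _ <-]; have := f0q x; rewrite /P.
  have : nu * w * `|g x| <= nu * w * (`|1 + g x| + 1).
    apply: ler_wpM2l; first by rewrite mulr_ge0// ltW.
    rewrite -[g x in leLHS](addKr 1) addrC (le_trans (ler_normD _ _))//.
    by rewrite normrN1.
  rewrite mulrDr; lra.
exists (inf (range P)) => x; set s := inf _; rewrite -/nu.
have sP y : s <= P y by apply: ge_inf => //; exists y.
have [gx|gx|gx] := ltgtP (g x) 0.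
- have c0 : 0 < - g x by rewrite oppr_gt0.
  have := sP ((- g x)^-1 *: x); rewrite /P qZ !fZ.
  have -> : 1 + (- g x)^-1 * g x = 0.
    by rewrite invrN mulNr mulVf ?subrr ?lt_eqF.
  rewrite normr0 mulr0 addr0 normfV gtr0_norm// mulrCA -mulrBr.
  by rewrite ler_pdivlMl//; lra.
(* here x is rescaled so that g x = 1, and compared with every P y *)
- have : f0 ((g x)^-1 *: x) - nu * q ((g x)^-1 *: x) <= s.
    apply: lb_le_inf; first by exists (P 0), 0.
    by move=> _ [y _ <-]; apply: Plb; rewrite fZ mulVf ?gt_eqF.
  rewrite qZ fZ normfV gtr0_norm// mulrCA -mulrBr ler_pdivrMl//; lra.
- by have := f0q x; rewrite gx normr0 !mulr0 addr0 subr0.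
Qed.

(** If [f0 = h + s g] is the splitting of [dual_split], then [h + s' g] has norm at
    most [|f0|] whenever [|s'| <= |f0| w]. A functional norming at [f0] is
    maximal at [s' = s] on this segment, so [s] is its right end if the
    functional is positive at [g], and its left end if it is negative: both
    cannot occur for the same [f0]. *)
Lemma dual_norming_sign (phi1 phi2 : dual V -> R) (f0 g : dual V) (w M : R)
    (q := fun x => `|x| - w * `|g x|) :
  0 < w -> (forall x y, q (x + y) <= q x + q y) ->
  linear phi1 -> linear phi2 ->
  (forall f, phi1 f <= M * `|f|) -> (forall f, phi2 f <= M * `|f|) ->
  f0 != 0 -> 0 <= M -> phi1 f0 = M * `|f0| -> phi2 f0 = M * `|f0| ->
  0 < phi1 g -> phi2 g < 0 -> False.
Proof.
move=> w0 qD l1 l2 b1 b2 f00 M0 e1 e2 g1 g2.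
have nu0 : 0 < `|f0| by rewrite normr_gt0.
have [s sP] : exists s, forall x, f0 x - s * g x <= `|f0| * q x.
  exact: dual_split.
have fZ (f : dual V) a x : f (a *: x) = a * f x := linearZZ (dual_linfun f) a x.
have qZ a x : q (a *: x) = `|a| * q x.
  by rewrite /q normrZ fZ normrM; ring.
have shift (s' : R) : `|s'| <= `|f0| * w -> `|(s' - s) *: g + f0| <= `|f0|.
  move=> s'w; apply: dual_norm_le => // x.
  have -> : ((s' - s) *: g + f0) x = s' * g x + (f0 x - s * g x).
    by rewrite /= !fctE /= /GRing.scale/=; ring.
  apply: le_trans (ler_normD _ _) _.
  have h1 : `|s' * g x| <= `|f0| * w * `|g x|.
    by rewrite normrM ler_wpM2r.
  have h2 : `|f0 x - s * g x| <= `|f0| * q x.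
    rewrite ler_norml sP andbT; have := sP (- 1 *: x).
    by rewrite !fZ qZ normrN1 mul1r; lra.
  have -> : `|f0| * `|x| = `|f0| * w * `|g x| + `|f0| * q x by rewrite /q; ring.
  exact: lerD.
have key (phi : dual V -> R) (s' : R) : linear phi ->
    (forall f, phi f <= M * `|f|) -> phi f0 = M * `|f0| ->
    `|s'| <= `|f0| * w -> (s' - s) * phi g <= 0.
  move=> lp bp ep /shift/(ler_wpM2l M0)/(le_trans (bp _)).
  by rewrite lp -ep /GRing.scale/=; lra.
have W0 : 0 < `|f0| * w by exact: mulr_gt0.
have := key phi1 (`|f0| * w) l1 b1 e1 ltac:(by rewrite gtr0_norm).
have := key phi2 (- (`|f0| * w)) l2 b2 e2 ltac:(by rewrite normrN gtr0_norm).
by rewrite (pmulr_lle0 _ g1) (nmulr_lle0 _ g2); lra.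
Qed.

End dual_theory.

(** * Strict convexity of the bidual of Read's space *)

Section read_dual.
Context (R : realType) (d : read_data) (Y : csubspace (read_space R d)).
Local Notation E := (dual (csub Y)).

Lemma read_coord_lin p : linear (fun x : read_space R d => c0_val x p : R).
Proof. by []. Qed.

Lemma coordinate_lin p : linear (fun y : csub Y => c0_val (csub_val y) p : R).
Proof. by move=> a x y; rewrite csub_val_lin; exact: read_coord_lin. Qed.

Lemma coordinate_le p (x : csub Y) : `|c0_val (csub_val x) p| <= 1 * `|x|.
Proof.
rewrite mul1r; apply: le_trans (read_norm_ge d (csub_val x)); exact: c0_le_norm.
Qed.

Definition coordinate p : E :=
  Dual (dual_pred_bounded (coordinate_lin p) (coordinate_le p)).

Lemma coordinate_norm p : `|coordinate p| <= 1.
Proof. by apply: dual_norm_le => // x; exact: coordinate_le. Qed.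
(** The functional [u_n - e_(a_n)]. *)
Definition pairing n : E :=
  \sum_(k < rd_a d n) ratr (rd_u d n k) *: coordinate k - coordinate (rd_a d n).-1.

Lemma pairingE n (y : csub Y) : pairing n y = read_pairing d (csub_val y) n.
Proof.
rewrite /pairing /read_pairing; congr (_ - _).
exact: (dual_sumE _ (fun k : 'I_(rd_a d n) => ratr (rd_u d n k) *: coordinate k)).
Qed.

Lemma series_ge_term (u : nat -> R) n : (forall i, 0 <= u i) ->
  cvgn (series u) -> u n <= limn (series u).
Proof.
move=> u0 cu; apply: le_trans (_ : series u n.+1 <= _).
  by rewrite /series/= big_nat_recr//= lerDr sumr_ge0.
apply: nondecreasing_cvgn_le => //.
by apply: nondecreasing_series => i _ _; exact: u0.
Qed.

(** Removing one summand from Read's norm leaves a seminorm, which is the splitting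
    of the norm to which [dual_norming_sign] applies. *)
Lemma read_norm_minus_term n (q := fun x : c0 R =>
    read_norm d x - read_weight R d n * `|read_pairing d x n|) (x y : c0 R) :
  q (x + y) <= q x + q y.
Proof.
have pD m : read_pairing d (x + y) m = read_pairing d x m + read_pairing d y m.
  by have := read_pairingP d 1 x y m; rewrite scale1r mul1r.
pose D m := read_weight R d m *
  (`|read_pairing d x m| + `|read_pairing d y m| - `|read_pairing d (x + y) m|).
have D0 m : 0 <= D m.
  by rewrite mulr_ge0 ?read_weight_ge0// subr_ge0 pD ler_normD.
pose T (z : c0 R) m := read_weight R d m * `|read_pairing d z m|.
have cT z : cvgn (series (T z)) by exact: read_cvg.
have sD : series D = series (T x) + series (T y) - series (T (x + y)).
  apply/funext => m; rewrite /series/= !fctE -big_split -sumrB /=.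
  by apply: eq_bigr => i _; rewrite /D /T; ring.
have cD : cvgn (series D).
  by rewrite sD; apply: is_cvgB; [apply: is_cvgD; exact: cT|exact: cT].
have := series_ge_term n D0 cD.
rewrite sD limB; [|by apply: is_cvgD; exact: cT|exact: cT].
rewrite limD; [|exact: cT..].
have := @ler_normD _ (c0 R) x y.
by rewrite /q /read_norm -/(T _) -/(T _) -/(T _) /D; lra.
Qed.

Section norming.
Variables (phi1 phi2 : E -> R) (f0 : E) (M : R).
Hypotheses (l1 : linear phi1) (l2 : linear phi2).
Hypotheses (b1 : forall f, phi1 f <= M * `|f|) (b2 : forall f, phi2 f <= M * `|f|).
Hypotheses (f00 : f0 != 0) (M0 : 0 <= M).
Hypotheses (e1 : phi1 f0 = M * `|f0|) (e2 : phi2 f0 = M * `|f0|).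

Lemma pairing_sign n : 0 < phi1 (pairing n) -> phi2 (pairing n) < 0 -> False.
Proof.
apply: (@dual_norming_sign _ _ _ _ f0 (pairing n) (read_weight R d n) M) => //.
  by rewrite exprn_gt0// invr_gt0.
move=> x y; rewrite !pairingE; exact: read_norm_minus_term.
Qed.

Lemma linear_form_pairing (phi : E -> R) n : linear phi ->
  phi (pairing n) = \sum_(k < rd_a d n) ratr (rd_u d n k) * phi (coordinate k)
     - phi (coordinate (rd_a d n).-1).
Proof.
move=> /linear_formP[phi0 pZ pD].
rewrite /pairing pD -scaleN1r pZ mulN1r; congr (_ - _).
by rewrite (big_morph phi pD phi0); apply: eq_bigr => k _; exact: pZ.
Qed.

Lemma rat_approx (x c : R) : 0 < c -> exists r : rat, `|ratr r - x| < c.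
Proof.
move=> c0; have [r] := @rat_in_itvoo R (x - c) (x + c) ltac:(lra).
by rewrite in_itv /= => /andP[? ?]; exists r; rewrite ltr_norml; lra.
Qed.

(** Were the minor nonzero, a linear combination of the coordinates [i] and [j]
    would take the value [M + 1] at [phi1] and [- (M + 1)] at [phi2], and some
    rational combination would come close enough. It is one of the [u_n];
    subtracting the coordinate [a_n], whose values are at most [M], does not
    change the signs, against [pairing_sign]. *)
Lemma norming_minor i j : phi1 (coordinate i) * phi2 (coordinate j) =
  phi1 (coordinate j) * phi2 (coordinate i).
Proof.
have [->//|ij] := eqVneq i j.
apply/eqP; apply: contrapT => /negP; rewrite -subr_eq0.
set a1 := phi1 _; set b2' := phi2 _; set a2 := phi1 _; set b1' := phi2 _.
set D := _ - _ => D0.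
(* x1 and x2 solve x1 a1 + x2 a2 = L and x1 b1' + x2 b2' = - L by Cramer. *)
pose L := M + 1.
pose x1 := L * (b2' + a2) / D; pose x2 := - L * (a1 + b1') / D.
have ex1 : x1 * a1 + x2 * a2 = L by rewrite /x1 /x2 /D; field.
have ex2 : x1 * b1' + x2 * b2' = - L by rewrite /x1 /x2 /D; field.
pose K := `|a1| + `|a2| + `|b1'| + `|b2'| + 1.
have K0 : 0 < K by rewrite ltr_wpDl// !addr_ge0.
have K10 : 0 < K^-1 by rewrite invr_gt0.
have [r1 r1x] := rat_approx x1 K10.
have [r2 r2x] := rat_approx x2 K10.
pose v k : rat := if k == i then r1 else if k == j then r2 else 0.
have fv : finsupp_rat v.
  exists (maxn i j).+1 => k; rewrite gtn_max => /andP[ik jk].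
  by rewrite /v !gtn_eqF.
have [n _ un] := rd_u_lists d fv 0.
have val (phi : E -> R) : linear phi -> phi (pairing n) =
    ratr r1 * phi (coordinate i) + ratr r2 * phi (coordinate j)
    - phi (coordinate (rd_a d n).-1).
  move=> lp; rewrite linear_form_pairing//; congr (_ - _).
  have ext m : (rd_a d n <= m)%N ->
      \sum_(k < rd_a d n) ratr (rd_u d n k) * phi (coordinate k) =
      \sum_(k < m) ratr (rd_u d n k) * phi (coordinate k).
    move=> am; rewrite
      (big_ord_widen _ (fun k => ratr (rd_u d n k) * phi (coordinate k)) am).
    rewrite big_mkcond; apply: eq_bigr => k _; case: ifPn => //.
    rewrite -leqNgt => ak; suff -> : rd_u d n k = 0 by rewrite rmorph0 mul0r.
    apply/eqP; apply: contraT => /rd_u_supp; lia.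
  pose m := maxn (rd_a d n) (maxn i j).+1.
  rewrite (ext m) ?leq_maxl// un.
  have im : (i < m)%N by rewrite /m; lia.
  have jm : (j < m)%N by rewrite /m; lia.
  rewrite (bigD1 (Ordinal im))//= (bigD1 (Ordinal jm))/=; last first.
    by rewrite -val_eqE /= eq_sym.
  rewrite big1 ?addr0; last first.
    move=> k /andP[]; rewrite -!val_eqE /= => ki kj.
    by rewrite /v (negPf ki) (negPf kj) rmorph0 mul0r.
  by rewrite /v !eqxx eq_sym (negPf ij).
have cM (phi : E -> R) p : linear phi -> (forall f, phi f <= M * `|f|) ->
    `|phi (coordinate p)| <= M.
  move=> lp bp; have cp : M * `|coordinate p| <= M by rewrite ler_piMr// coordinate_norm.
  have [_ pZ _] := linear_formP lp.
  rewrite ler_norml (le_trans (bp _) cp) andbT lerNl.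
  have : phi (- coordinate p) <= M * `|- coordinate p| by exact: bp.
  by rewrite normrN -scaleN1r pZ mulN1r => /le_trans; apply.
have close (x y : R) (a b : R) : `|x| + `|y| <= K - 1 -> `|a| < K^-1 -> `|b| < K^-1 ->
    `|a * x + b * y| < 1.
  move=> xy aK bK; apply: le_lt_trans (ler_normD _ _) _; rewrite !normrM.
  apply: (@le_lt_trans _ _ (K^-1 * (K - 1))).
    apply: le_trans (_ : K^-1 * (`|x| + `|y|) <= _).
      by rewrite mulrDr lerD// ler_wpM2r// ltW.
    by rewrite ler_pM2l.
  by rewrite mulrBr mulVf ?gt_eqF// mulr1; lra.
apply: (@pairing_sign n).
- rewrite val// -/a1 -/a2.
  have := cM _ (rd_a d n).-1 l1 b1; rewrite ler_norml => /andP[_ h].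
  have := close a1 a2 (ratr r1 - x1) (ratr r2 - x2) _ r1x r2x.
  rewrite ltr_norml => /(_ _)/andP[|h1 _].
    rewrite /K; have := normr_ge0 b1'; have := normr_ge0 b2'; lra.
  move: h1 h ex1; rewrite /L; lra.
- rewrite val// -/b1' -/b2'.
  have := cM _ (rd_a d n).-1 l2 b2; rewrite ler_norml => /andP[h _].
  have := close b1' b2' (ratr r1 - x1) (ratr r2 - x2) _ r1x r2x.
  rewrite ltr_norml => /(_ _)/andP[|_ h1].
    rewrite /K; have := normr_ge0 a1; have := normr_ge0 a2; lra.
  move: h1 h ex2; rewrite /L; lra.
Qed.

End norming.
End read_dual.

(** * Davie's vectors and their coefficients *)

Section davie_vectors.
Context (R : realType) (D : davie_system R).
Local Notation s := (ds_s D).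
Local Notation t := (ds_t D).

(** Block [l] consists of the coordinates from [2 ^ (l + 1)] to [2 ^ (l + 2) - 1], so
    consecutive blocks are adjacent and the coordinates 0 and 1 belong to none. *)
Definition davie_fun k (j p : nat) : R :=
  if (p < 2 ^ k.+1)%N then 0
  else if (p < 2 ^ k.+2)%N then t k j (p - 2 ^ k.+1)
  else if (p < 2 ^ k.+3)%N then s k j (p - 2 ^ k.+2) else 0.

Lemma block_ex p : (1 < p)%N -> exists l g, (g < 2 ^ l.+1)%N /\ p = (2 ^ l.+1 + g)%N.
Proof.
move=> p1; pose l := (trunc_log 2 p).-1.
have lE : l.+1 = trunc_log 2 p by rewrite prednK// trunc_log_gt0.
exists l, (p - 2 ^ l.+1)%N.
have := trunc_logP (ltnSn 1) (ltnW p1); have := trunc_log_ltn p (ltnSn 1).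
rewrite -lE [(2 ^ l.+2)%N]expnS; lia.
Qed.

Lemma davie_fun_block k j l g : (g < 2 ^ l.+1)%N ->
  davie_fun k j (2 ^ l.+1 + g) =
    if l == k then t k j g else if l == k.+1 then s k j g else 0.
Proof.
move=> gl; rewrite /davie_fun.
have lt m : (l < m)%N -> (2 ^ l.+1 + g < 2 ^ m.+1)%N.
  move=> lm; apply: (@leq_trans (2 ^ l.+2)).
    by rewrite [(2 ^ l.+2)%N]expnS; lia.
  by rewrite leq_exp2l.
have ge m : (m <= l)%N -> (2 ^ l.+1 + g < 2 ^ m.+1)%N = false.
  move=> ml; apply/negbTE; rewrite -leqNgt.
  by apply: leq_trans (leq_addr _ _); rewrite leq_exp2l.
have [lk|kl|lk] := ltngtP l k.
- by rewrite (lt k lk) ltn_eqF// ltnW.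
- rewrite (ge k (ltnW kl)) (ge k.+1 kl); have [lk|lk] := eqVneq l k.+1.
    by rewrite lk in gl *; rewrite ifT ?addKn// [(2 ^ k.+3)%N]expnS; lia.
  by rewrite ge// ltn_neqAle eq_sym lk.
- by rewrite -lk ge// lt// addKn.
Qed.

Lemma davie_fun_le1 k j p : `|davie_fun k j p| <= 1.
Proof.
by rewrite /davie_fun; do 3?case: ifP => _; rewrite ?normr0// ?ds_t_le1 ?ds_s_le1.
Qed.

Lemma davie_fun_small k j p : (p < 2 ^ k.+1)%N -> davie_fun k j p = 0.
Proof. by rewrite /davie_fun => ->. Qed.

Lemma davie_fun_c0 k j : davie_fun k j \in @c0_pred R.
Proof.
apply/c0_predP; apply/cvgrPdist_lt => e e0; near=> p.
rewrite sub0r normrN.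
suff -> : davie_fun k j p = 0 by rewrite normr0.
have : (2 ^ k.+3 <= p)%N by near: p; exists (2 ^ k.+3)%N.
have : (2 ^ k.+1 <= 2 ^ k.+3)%N by rewrite leq_exp2l// leqW.
have : (2 ^ k.+2 <= 2 ^ k.+3)%N by rewrite leq_exp2l.
move=> h2 h1 h3; rewrite /davie_fun !ltnNge.
by rewrite (leq_trans h1 h3) (leq_trans h2 h3) h3.
Unshelve. all: by end_near. Qed.

Definition davie_c0 k j : c0 R := C0 (davie_fun_c0 k j).

(** The two formulas for the coefficient of a vector along [davie_fun k j], on the
    first and on the second of the blocks that support it. *)
Definition coef_t k j (y : nat -> R) : R :=
  2 ^- k.+1 * \sum_(g < 2 ^ k.+1) t k j g * y (2 ^ k.+1 + g)%N.

Definition coef_s k j (y : nat -> R) : R :=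
  2 ^- k.+2 * \sum_(g < 2 ^ k.+2) s k j g * y (2 ^ k.+2 + g)%N.

Lemma coef_tE l i k j : (i < 2 ^ l)%N -> (j < 2 ^ k)%N ->
  coef_t l i (davie_fun k j) = (if l == k then i == j else false)%:R.
Proof.
move=> il jk; rewrite /coef_t.
under eq_bigr => g do rewrite davie_fun_block//.
have [lk|lk] := eqVneq l k.
  by rewrite -lk in jk *; rewrite ds_t_orth// mulKf// expf_neq0.
have [lk'|lk'] := eqVneq l k.+1; last first.
  by rewrite big1 ?mulr0// => g _; rewrite mulr0.
rewrite lk' in il *; under eq_bigr do rewrite mulrC.
by rewrite ds_st_orth// mulr0.
Qed.

Lemma coef_sE l i k j : (i < 2 ^ l)%N -> (j < 2 ^ k)%N ->
  coef_s l i (davie_fun k j) = (if l == k then i == j else false)%:R.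
Proof.
move=> il jk; rewrite /coef_s.
under eq_bigr => g do rewrite davie_fun_block// eqSS.
have [lk|lk] := eqVneq l.+1 k.
  rewrite -lk in jk *; rewrite ds_st_orth// mulr0.
  by rewrite ltn_eqF.
have [lk'|lk'] := eqVneq l k; last first.
  by rewrite big1 ?mulr0// => g _; rewrite mulr0.
by rewrite -lk' in jk *; rewrite ds_s_orth// mulKf// expf_neq0.
Qed.

Lemma coef_t_lin k j (a : R) x y :
  coef_t k j (a *: x + y) = a * coef_t k j x + coef_t k j y.
Proof.
rewrite /coef_t mulrCA -mulrDr [a * _]mulr_sumr -big_split/=; congr (_ * _).
by apply: eq_bigr => g _; rewrite !fctE /GRing.scale/=; ring.
Qed.

Lemma coef_s_lin k j (a : R) x y :
  coef_s k j (a *: x + y) = a * coef_s k j x + coef_s k j y.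
Proof.
rewrite /coef_s mulrCA -mulrDr [a * _]mulr_sumr -big_split/=; congr (_ * _).
by apply: eq_bigr => g _; rewrite !fctE /GRing.scale/=; ring.
Qed.

Lemma coef_bound (n : nat) (f y : nat -> R) (c : R) :
  (forall g, `|f g| <= 1) -> (forall p, `|y p| <= c) ->
  `|2 ^- n * \sum_(g < 2 ^ n) f g * y (2 ^ n + g)%N| <= c.
Proof.
move=> f1 yc; rewrite normrM normfV normrX ger0_norm// ler_pdivrMl ?exprn_gt0//.
apply: le_trans (ler_norm_sum _ _ _) _.
apply: (@le_trans _ _ (\sum_(g < 2 ^ n) c)).
  apply: ler_sum => g _; rewrite normrM (le_trans _ (yc (2 ^ n + g)%N))//.
  by rewrite ler_piMl.
by rewrite sumr_const card_ord -[_ *+ (2 ^ _)]mulr_natl natrX.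
Qed.

(** The functions [t k j] are orthogonal with mean square 1 on block [k], and the
    mean square of [y] there is at most [c ^ 2]. *)
Lemma bessel k (y : nat -> R) (c : R) : (forall p, `|y p| <= c) ->
  \sum_(j < 2 ^ k) coef_t k j y ^+ 2 <= c ^+ 2.
Proof.
move=> yc; pose N : R := 2 ^+ k.+1; have N0 : 0 < N by exact: exprn_gt0.
pose a j := coef_t k j y; pose z g := y (2 ^ k.+1 + g)%N.
have aE j : \sum_(g < 2 ^ k.+1) t k j g * z g = N * a j.
  by rewrite /a /coef_t mulrA divff ?mul1r// gt_eqF.
pose A := \sum_(j < 2 ^ k) a j ^+ 2.
have cross : \sum_(g < 2 ^ k.+1) z g * \sum_(j < 2 ^ k) a j * t k j g = N * A.
  under eq_bigr do rewrite mulr_sumr.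
  rewrite exchange_big/= /A mulr_sumr; apply: eq_bigr => j _.
  have -> : N * a j ^+ 2 = a j * (N * a j) by ring.
  by rewrite -aE [RHS]mulr_sumr; apply: eq_bigr => g _; ring.
have square : \sum_(g < 2 ^ k.+1) (\sum_(j < 2 ^ k) a j * t k j g) ^+ 2 = N * A.
  under eq_bigr do rewrite expr2 mulr_suml.
  rewrite exchange_big/= /A mulr_sumr; apply: eq_bigr => j _.
  under eq_bigr do rewrite mulr_sumr.
  rewrite exchange_big/= (bigD1 j)//= [X in _ + X]big1 ?addr0; last first.
    move=> i ij; under eq_bigr do rewrite mulrACA.
    by rewrite -mulr_sumr ds_t_orth// val_eqE eq_sym (negPf ij) !mulr0.
  under eq_bigr do rewrite mulrACA.
  by rewrite -mulr_sumr ds_t_orth// eqxx mulr1 mulrC expr2.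
have : 0 <= \sum_(g < 2 ^ k.+1) (z g - \sum_(j < 2 ^ k) a j * t k j g) ^+ 2.
  by apply: sumr_ge0 => g _; exact: sqr_ge0.
under eq_bigr do rewrite sqrrB.
rewrite big_split sumrB/= sumrMnl cross square => h.
have zc : \sum_(g < 2 ^ k.+1) z g ^+ 2 <= N * c ^+ 2.
  have -> : N * c ^+ 2 = \sum_(g < 2 ^ k.+1) c ^+ 2.
    by rewrite sumr_const card_ord -[_ *+ (2 ^ _)]mulr_natl natrX.
  apply: ler_sum => g _; rewrite -[z g ^+ 2]real_normK ?num_real//.
  have c0 : 0 <= c := le_trans (normr_ge0 _) (yc 0%N).
  by rewrite lerXn2r ?nnegrE//; exact: yc.
have : N * A <= N * c ^+ 2 by move: h zc; rewrite mulr2n; lra.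
by rewrite ler_pM2l.
Qed.

End davie_vectors.

(** * Davie's space, with the sup norm and with Read's norm *)

Section davie_space.
Context (R : realType) (D : davie_system R).
Local Notation s := (ds_s D).
Local Notation t := (ds_t D).

(** On the space cut out by these equations [coef_t] and [coef_s] are one
    functional, so that two consecutive levels can be compared on the block that
    they share. The vectors [davie_fun k j] satisfy them by orthogonality. *)
Definition davie_eqs (y : nat -> R) :=
  forall k j, (j < 2 ^ k)%N -> coef_t D k j y = coef_s D k j y.

Lemma davie_eqs0 : davie_eqs 0.
Proof.
move=> k j _; rewrite /coef_t /coef_s !big1 ?mulr0// => g _; exact: mulr0.
Qed.

Lemma davie_eqs_lin (a : R) x y :
  davie_eqs x -> davie_eqs y -> davie_eqs (a *: x + y).
Proof.
by move=> ex ey k j jk; rewrite coef_t_lin coef_s_lin ex// ey.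
Qed.

(** Stated for a map [v] into the null sequences so as to cover the closedness for
    both norms. *)
Lemma davie_eqs_closed (V : normedModType R) (v : V -> c0 R) : linear v ->
  (forall x, `|v x| <= `|x|) -> closed [set x | davie_eqs (v x)].
Proof.
move=> lv vle.
have eqsE : [set x | davie_eqs (v x)] =
    \bigcap_(kj in [set kj : nat * nat | (kj.2 < 2 ^ kj.1)%N])
      [set x | coef_t D kj.1 kj.2 (v x) - coef_s D kj.1 kj.2 (v x) = 0].
  apply/seteqP; split=> [x ex [k j] /= jk|x ex k j jk].
    by rewrite ex// subrr.
  by apply/eqP; rewrite -subr_eq0; apply/eqP; exact: (ex (k, j)).
rewrite eqsE; apply: closed_bigI => -[k j] _ /=.
have fin : (fun x => coef_t D k j (v x) - coef_s D k j (v x)) \in @dual_pred R V.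
  apply: (@dual_pred_bounded _ _ _ 2) => [a x y|x].
    by rewrite lv coef_t_lin coef_s_lin /GRing.scale/=; ring.
  have vx p : `|v x p| <= `|x| by exact: le_trans (c0_le_norm _ _) (vle x).
  rewrite (_ : 2 = 1 + 1)// mulrDl mul1r (le_trans (ler_normB _ _))// lerD//.
    by apply: coef_bound => // g; exact: ds_t_le1.
  by apply: coef_bound => // g; exact: ds_s_le1.
have /dual_predP[_ cf] := fin.
by apply: (@closed_comp _ _ _ [set 0] _ (@closed_eq _ 0)) => x _; exact: cf.
Qed.

Definition davie_X : csubspace (c0 R) :=
  @CSubspace R (c0 R) (fun x => davie_eqs x) davie_eqs0
    (fun a x y => @davie_eqs_lin a x y)
    (@davie_eqs_closed (c0 R) id (fun a x y => erefl) (fun x => lexx _)).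

Variable d : read_data.

Definition davie_Y : csubspace (read_space R d) :=
  @CSubspace R (read_space R d) (fun x => davie_eqs (x : c0 R)) davie_eqs0
    (fun a x y => @davie_eqs_lin a (x : c0 R) (y : c0 R))
    (@davie_eqs_closed (read_space R d) (fun x => x : c0 R)
      (fun a x y => erefl) (fun x => read_norm_ge d x)).

Local Notation X := (csub davie_X).
Local Notation Y := (csub davie_Y).

Lemma davie_fun_eqs k j : (j < 2 ^ k)%N -> davie_eqs (davie_fun D k j).
Proof. by move=> jk l i il; rewrite coef_tE// coef_sE. Qed.

Lemma davie_vec_in k (j : 'I_(2 ^ k)) :
  davie_c0 D k j \in csub_pred davie_X.
Proof. exact/mem_set/davie_fun_eqs. Qed.

Definition davie_vec k (j : 'I_(2 ^ k)) : X := CSub (davie_vec_in j).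

(** The identity map from the sup norm to Read's norm. *)
Definition renorm (x : X) : Y :=
  @CSub R _ davie_Y (csub_val x) (csub_valP x).

End davie_space.

(** * The tensors of trace one *)

Section csub_c0.
Context (R : realType) (S : csubspace (c0 R)).
Implicit Types x y : csub S.

Lemma c0_lin p : linear (fun x : c0 R => c0_val x p : R).
Proof. by []. Qed.

Lemma csub_coord_lin p : linear (fun x : csub S => c0_val (csub_val x) p : R).
Proof. by move=> a x y; rewrite csub_val_lin; exact: c0_lin. Qed.

Lemma csub_coordD x y p : c0_val (csub_val (x + y)) p =
  c0_val (csub_val x) p + c0_val (csub_val y) p.
Proof. by have [_ _] := linear_formP (csub_coord_lin p). Qed.

Lemma csub_coordZ (a : R) x p :
  c0_val (csub_val (a *: x)) p = a * c0_val (csub_val x) p.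
Proof. by have [_ + _] := linear_formP (csub_coord_lin p). Qed.

Lemma csub_coordB x y p : c0_val (csub_val (x - y)) p =
  c0_val (csub_val x) p - c0_val (csub_val y) p.
Proof. by rewrite csub_coordD -scaleN1r csub_coordZ mulN1r. Qed.

Lemma csub_coord_sum I (r : seq I) (f : I -> csub S) p :
  c0_val (csub_val (\sum_(i <- r) f i)) p =
  \sum_(i <- r) c0_val (csub_val (f i)) p.
Proof.
have [p0 _ _] := linear_formP (csub_coord_lin p).
by elim: r => [|i r ih]; rewrite ?big_nil// !big_cons csub_coordD ih.
Qed.

End csub_c0.

Section tensor_sums.
Context (R : realType) (X Z : lmodType R).

Lemma tens_suml I (r : seq I) (f : I -> X) (z : Z) :
  tens (\sum_(i <- r) f i) z = \sum_(i <- r) tens (f i) z.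
Proof.
apply: (big_morph (fun x : X => tens x z)) => [x y|]; first exact: tensDl.
by rewrite -[X in tens X z](scale0r (0 : X)) tensZl scale0r.
Qed.

Lemma tens_sumr I (r : seq I) (x : X) (f : I -> Z) :
  tens x (\sum_(i <- r) f i) = \sum_(i <- r) tens x (f i).
Proof.
apply: (big_morph (fun z : Z => tens x z)) => [z y|]; first exact: tensDr.
by rewrite -[X in tens x X](scale0r (0 : Z)) tensZr scale0r.
Qed.

End tensor_sums.

Section projective_tensor.
Context (R : realType) (X Z : normedModType R).

Lemma ptens_lincomb (a : R) n (x : 'I_n -> X) (z : 'I_n -> Z) :
  to_completion (pi_seminorm X Z) (a *: \sum_(j < n) tens (x j) (z j)) =
  a *: \sum_(j < n) ptens (x j) (z j).
Proof. by rewrite linearZ raddf_sum. Qed.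

Lemma proj_tensor_is_cvg (u : nat -> tensor X Z) (b : nat -> R) :
  (forall k, pi_norm (u k.+1 - u k) <= b k) -> cvgn (series b) ->
  cvgn (fun k => to_completion (pi_seminorm X Z) (u k)).
Proof.
move=> ub cb; pose w k := to_completion (pi_seminorm X Z) (u k).
have -> : (fun k => to_completion (pi_seminorm X Z) (u k)) =
    cst (w 0%N) + series (telescope w).
  by apply/funext => k; rewrite -/(w k) [LHS]eq_sum_telescope.
apply: is_cvgD; first exact: is_cvg_cst.
apply: (@normed_cvg R (proj_tensor X Z)).
have wb k : `|telescope w k| <= b k.
  by rewrite /telescope /= -raddfB to_completion_norm; exact: ub.
apply: (series_le_cvg _ _ wb cb) => k; first exact: normr_ge0.
exact: le_trans (normr_ge0 _) (wb k).
Qed.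

End projective_tensor.

Section davie_tensor.
Context (R : realType) (d : read_data) (D : davie_system R).
Local Notation s := (ds_s D).
Local Notation t := (ds_t D).
Local Notation X := (csub (davie_X D)).
Local Notation Y := (csub (davie_Y D d)).
Local Notation coord := (@coordinate R d (davie_Y D d)).
Local Notation vec := (@davie_vec R D).

Definition coef k (j : 'I_(2 ^ k)) : dual Y :=
  2 ^- k.+1 *: \sum_(g < 2 ^ k.+1) t k j g *: coord (2 ^ k.+1 + g)%N.

Lemma coefE_t k (j : 'I_(2 ^ k)) (y : Y) :
  coef j y = coef_t D k j (csub_val y : c0 R).
Proof.
rewrite /coef_t /coef /= fctE; congr (_ * _).
exact: (dual_sumE _ (fun g : 'I_(2 ^ k.+1) => t k j g *: coord (2 ^ k.+1 + g)%N)).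
Qed.

Lemma coefE_s k (j : 'I_(2 ^ k)) :
  coef j = 2 ^- k.+2 *: \sum_(g < 2 ^ k.+2) s k j g *: coord (2 ^ k.+2 + g)%N.
Proof.
apply: dual_ext => y; have /set_mem ey := csub_valP y.
rewrite coefE_t ey// /coef_s /= fctE; congr (_ * _); apply/esym.
exact: (dual_sumE _ (fun g : 'I_(2 ^ k.+2) => s k j g *: coord (2 ^ k.+2 + g)%N)).
Qed.

(** As an operator this is [2 ^- k] times a projection of rank [2 ^ k]. *)
Definition davie_tensor k : tensor X (dual Y) :=
  2 ^- k *: \sum_(j < 2 ^ k) tens (vec j) (coef j).

(** The coefficient of the point [g] of block [k + 1] in [davie_tensor_diff]. *)
Definition davie_diff k g : X :=
  2 ^- k.+1 *: \sum_(j < 2 ^ k.+1) t k.+1 j g *: vec j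
  - 2 ^- k *: \sum_(j < 2 ^ k) s k j g *: vec j.

(** Both coefficient functionals are expanded on block [k + 1]: those of level
    [k + 1] by the first formula, those of level [k] by the second. *)
Lemma davie_tensor_diff k : davie_tensor k.+1 - davie_tensor k =
  2 ^- k.+2 *: \sum_(g < 2 ^ k.+2) tens (davie_diff k g) (coord (2 ^ k.+2 + g)%N).
Proof.
have swap m (f : 'I_(2 ^ m) -> nat -> R) :
    2 ^- m *: (\sum_(j < 2 ^ m) tens (vec j)
      (2 ^- k.+2 *: \sum_(g < 2 ^ k.+2) f j g *: coord (2 ^ k.+2 + g)%N)) =
    2 ^- k.+2 *: \sum_(g < 2 ^ k.+2)
      tens (2 ^- m *: \sum_(j < 2 ^ m) f j g *: vec j) (coord (2 ^ k.+2 + g)%N).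
  rewrite !scaler_sumr.
  under eq_bigr => j _.
    rewrite tensZr tens_sumr scaler_sumr scaler_sumr.
    over.
  rewrite exchange_big/=; apply: eq_bigr => g _.
  rewrite tensZl tens_suml !scaler_sumr; apply: eq_bigr => j _.
  by rewrite tensZr tensZl !scalerA; congr (_ *: _); ring.
rewrite /davie_tensor; under [in X in _ - X]eq_bigr do rewrite coefE_s.
rewrite (swap k.+1 (fun j g => t k.+1 j g)) (swap k (fun j g => s k j g)).
rewrite -scalerBr -sumrB; congr (_ *: _); apply: eq_bigr => g _.
by rewrite /davie_diff -[X in _ - X]scale1r -scaleNr -tensZl scaleN1r -tensDl.
Qed.

Lemma davie_diffE k g p : c0_val (csub_val (davie_diff k g)) p =
  2 ^- k.+1 * (\sum_(j < 2 ^ k.+1) t k.+1 j g * davie_fun D k.+1 j p)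
  - 2 ^- k * (\sum_(j < 2 ^ k) s k j g * davie_fun D k j p).
Proof.
rewrite /davie_diff csub_coordB !csub_coordZ !csub_coord_sum.
by congr (_ * _ - _ * _); apply: eq_bigr => j _; rewrite csub_coordZ.
Qed.

Lemma davie_bound_ge0 k : 0 <= davie_bound R k.
Proof. by rewrite /davie_bound mulr_ge0// exprn_ge0//; lra. Qed.

Lemma davie_boundS k : davie_bound R k.+1 <= davie_bound R k.
Proof.
rewrite /davie_bound exprS.
have : 0 <= (27 / 32 : R) ^+ k by rewrite exprn_ge0//; lra.
lra.
Qed.

(** Only blocks [k], [k + 1] and [k + 2] matter. On the outer two the coordinates
    are correlations between consecutive blocks, bounded by [ds_mix]; on the
    middle one they are the difference of two kernels, bounded by [ds_gram]. *)
Lemma davie_diff_norm k g : (g < 2 ^ k.+2)%N ->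
  `|davie_diff k g| <= 2 * davie_bound R k.
Proof.
move=> gk; apply: sup_norm_ub; first by exists 0%N.
move=> p _; rewrite davie_diffE.
have b0 := davie_bound_ge0 k.
have pow0 m : 0 < 2 ^+ m :> R by rewrite exprn_gt0.
have scaled m (S c : R) : `|S| <= 2 ^+ m * c -> `|2 ^- m * S| <= c.
  by move=> Sc; rewrite normrM gtr0_norm ?invr_gt0// ler_pdivrMl.
have [p1|p1] := leqP p 1.
  have p4 m : (p < 2 ^ m.+1)%N.
    by apply: leq_ltn_trans p1 _; rewrite -{1}(expn0 2) ltn_exp2l.
  rewrite !big1 ?mulr0 ?subr0 ?normr0 ?mulr_ge0//.
    by move=> j _; rewrite davie_fun_small// mulr0.
  by move=> j _; rewrite davie_fun_small// mulr0.
have [l [h [hl pE]]] := block_ex p1.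
have E m j : davie_fun D m j p =
    if l == m then t m j h else if l == m.+1 then s m j h else 0.
  by rewrite pE davie_fun_block.
under eq_bigr do rewrite E.
under [in X in _ - X]eq_bigr do rewrite E.
have [lk|lk] := eqVneq l k.
  rewrite lk in hl *; rewrite ltn_eqF// ltn_eqF; last by [].
  rewrite big1 ?mulr0 ?sub0r ?normrN; last by move=> j _; rewrite mulr0.
  apply: (@le_trans _ _ (davie_bound R k)); last by lra.
  apply: scaled; under eq_bigr do rewrite mulrC.
  exact: ds_mix.
have [lk1|lk1] := eqVneq l k.+1.
  rewrite lk1 in hl *.
  have -> : 2 ^- k.+1 * (\sum_(j < 2 ^ k.+1) t k.+1 j g * t k.+1 j h)
      - 2 ^- k * (\sum_(j < 2 ^ k) s k j g * s k j h) =
     2 ^- k.+1 * (\sum_(j < 2 ^ k.+1) t k.+1 j g * t k.+1 j h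
      - 2 * \sum_(j < 2 ^ k) s k j g * s k j h).
    by rewrite exprS; field; rewrite gt_eqF.
  apply: scaled; apply: le_trans (ds_gram D gk hl) _.
  by rewrite exprS le_eqVlt; apply/orP; left; apply/eqP; ring.
rewrite [in X in _ - X]big1 ?mulr0 ?subr0; last by move=> j _; rewrite mulr0.
have [lk2|lk2] := eqVneq l k.+2.
  rewrite lk2 in hl *.
  apply: (@le_trans _ _ (davie_bound R k.+1)); last first.
    by have := davie_boundS k; lra.
  apply: scaled; exact: ds_mix.
rewrite big1 ?mulr0 ?normr0; last by move=> j _; rewrite mulr0.
lra.
Qed.

Lemma davie_tensor_cauchy k :
  pi_norm (davie_tensor k.+1 - davie_tensor k) <= 2 * davie_bound R k.
Proof.
rewrite davie_tensor_diff (pi_normZ (X := X) (Z := dual Y)).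
rewrite gtr0_norm ?invr_gt0 ?exprn_gt0// ler_pdivrMl ?exprn_gt0//.
pose r := [seq (davie_diff k g, coord (2 ^ k.+2 + g)%N)
  | g : 'I_(2 ^ k.+2) <- index_enum 'I_(2 ^ k.+2)].
apply: (@le_trans _ _ (cost r)); first by apply: pi_norm_le; rewrite big_map.
rewrite /cost big_map.
have -> : 2 ^+ k.+2 * (2 * davie_bound R k) =
    \sum_(g < 2 ^ k.+2) 2 * davie_bound R k.
  by rewrite sumr_const card_ord -[_ *+ (2 ^ _)]mulr_natl natrX.
apply: ler_sum => g _ /=; rewrite -[leRHS]mulr1 ler_pM//.
  exact: davie_diff_norm.
exact: coordinate_norm.
Qed.

Definition trace_form (x : X) (f : dual Y) : R := f (renorm d x).

Lemma trace_form_bilinear : bilinear_for *:%R *:%R trace_form.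
Proof.
split=> [f|x] a u v //.
by rewrite /trace_form -[RHS](dual_linear f); congr (f _); exact: val_inj.
Qed.

HB.instance Definition _ :=
  bilinear_isBilinear.Build R X (dual Y) R *:%R *:%R trace_form trace_form_bilinear.

Definition trace_bilform : bilform X (dual Y) := trace_form.

(** The trace is bounded on the tensor product because Read's norm is at most 3
    times the sup norm. *)
Lemma trace_le (u : tensor X (dual Y)) :
  tensor_val u trace_bilform <= 3 * pi_norm u.
Proof.
rewrite -ler_pdivrMl//; apply/ler_addgt0Pr => e e0.
have [r ur re] := pi_norm_adherent u e0.
apply: le_trans (ltW re); rewrite ler_pdivrMl// ur.
have -> : tensor_val (\sum_(p <- r) tens p.1 p.2) trace_bilform =
    \sum_(p <- r) trace_form p.1 p.2.
  exact: (big_morph (fun v : tensor X (dual Y) => tensor_val v trace_bilform)).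
rewrite /cost mulr_sumr; apply: ler_sum => p _.
apply: le_trans (ler_norm _) _; apply: le_trans (dual_le _ _) _.
rewrite mulrC mulrA ler_wpM2r//; exact: read_norm_le.
Qed.

Lemma davie_tensor_norm k : 3^-1 <= pi_norm (davie_tensor k).
Proof.
rewrite -[leLHS]mulr1 ler_pdivrMl//; apply: le_trans (trace_le _).
rewrite /davie_tensor /= fctE.
have -> : tensor_val (\sum_(j < 2 ^ k) tens (vec j) (coef j)) trace_bilform =
    \sum_(j < 2 ^ k) coef j (renorm d (vec j)).
  exact: (big_morph (fun v : tensor X (dual Y) => tensor_val v trace_bilform)).
under eq_bigr => j _ do rewrite coefE_t /= coef_tE// eqxx eqxx.
by rewrite sumr_const card_ord natrX /GRing.scale/= mulVf ?expf_neq0.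
Qed.

End davie_tensor.

(** * Norming functionals vanish at the limit tensor *)

Section norming_functionals.
Context (R : realType) (d : read_data) (D : davie_system R).
Local Notation X := (csub (davie_X D)).
Local Notation Y := (csub (davie_Y D d)).
Local Notation T := (proj_tensor X (dual Y)).
Local Notation coordinate := (@coordinate R d (davie_Y D d)).
Local Notation vec := (@davie_vec R D).
Local Notation coef := (@coef R d D).

(** By Bessel's inequality the square sum of the coefficients of a unit vector is at
    most 1, so by Cauchy-Schwarz their mean modulus is at most [2 ^ (- k / 2)]. *)
Lemma coef_mean_small (e : R) : 0 < e -> exists K, forall k (a : 'I_(2 ^ k) -> R),
  (K <= k)%N -> (forall j, `|a j| <= 1) ->
  `|2 ^- k *: \sum_(j < 2 ^ k) a j *: coef j| <= e.
Proof.
move=> e0.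
have : (fun k => (2^-1 : R) ^+ k) @ \oo --> 0.
  by apply: cvg_expr; rewrite ger0_norm ?invr_ge0// invf_lt1// ltr1n.
move=> /cvgrPdist_lt/(_ (e ^+ 2) (exprn_gt0 2 e0))[K _ KP].
exists K => k a Kk a1; apply: dual_norm_le; first exact: ltW.
move=> y; have n0 : 0 < 2 ^+ k :> R by exact: exprn_gt0.
have ke : 2 ^- k <= e ^+ 2.
  have := KP k Kk; rewrite sub0r normrN exprVn gtr0_norm ?invr_gt0//.
  exact: ltW.
pose al j := coef_t D k j (csub_val y : c0 R).
pose S := \sum_(j < 2 ^ k) `|al j|.
have S0 : 0 <= S by rewrite sumr_ge0.
have yp p : `|(csub_val y : c0 R) p| <= `|y|.
  exact: le_trans (c0_le_norm _ _) (read_norm_ge d (csub_val y)).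
have cauchy : S ^+ 2 <= 2 ^+ k * \sum_(j < 2 ^ k) al j ^+ 2.
  have : 0 <= \sum_(j < 2 ^ k) (2 ^+ k * `|al j| - S) ^+ 2.
    by apply: sumr_ge0 => j _; exact: sqr_ge0.
  have -> : \sum_(j < 2 ^ k) (2 ^+ k * `|al j| - S) ^+ 2 =
      \sum_(j < 2 ^ k) ((2 ^+ k) ^+ 2 * al j ^+ 2 - 2 * 2 ^+ k * S * `|al j| + S ^+ 2).
    apply: eq_bigr => j _; rewrite -[al j ^+ 2]real_normK ?num_real//; ring.
  rewrite big_split sumrB/= -!mulr_sumr -/S sumr_const card_ord.
  rewrite -[_ *+ (2 ^ _)]mulr_natl natrX => h.
  rewrite -(ler_pM2l n0); move: h; rewrite !expr2; lra.
have -> : (2 ^- k *: \sum_(j < 2 ^ k) a j *: coef j : dual Y) y =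
    2 ^- k * \sum_(j < 2 ^ k) a j * al j.
  rewrite /= fctE; congr (_ * _);
  rewrite (dual_sumE _ (fun j : 'I_(2 ^ k) => a j *: coef j)).
  by apply: eq_bigr => j _; rewrite /al -coefE_t.
rewrite normrM gtr0_norm ?invr_gt0//.
apply: (@le_trans _ _ (2 ^- k * S)).
  rewrite ler_pM2l ?invr_gt0// (le_trans (ler_norm_sum _ _ _))//.
  by apply: ler_sum => j _; rewrite normrM ler_piMl.
rewrite -(@ler_pXn2r _ 2) ?nnegrE ?mulr_ge0 ?invr_ge0 ?(ltW n0) ?(ltW e0)//.
rewrite !exprMn.
apply: (@le_trans _ _ (2 ^- k * `|y| ^+ 2)); last by rewrite ler_wpM2r ?sqr_ge0.
rewrite expr2 -mulrA ler_pM2l ?invr_gt0// ler_pdivrMl//.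
apply: le_trans cauchy _; rewrite ler_pM2l//.
exact: (bessel D k yp).
Qed.

Definition davie_seq k : T :=
  to_completion (pi_seminorm X (dual Y)) (davie_tensor d D k).

Lemma davie_seq_cvg : cvgn davie_seq.
Proof.
apply: (proj_tensor_is_cvg (davie_tensor_cauchy d D)).
have -> : (fun k => 2 * davie_bound R k) = geometric (2 * 49) (27 / 32).
  by apply/funext => k; rewrite /davie_bound mulrA.
by apply: is_cvg_geometric_series; rewrite ger0_norm; lra.
Qed.

Definition davie_lim : T := limn davie_seq.

Lemma davie_lim_norm : 3^-1 <= `|davie_lim|.
Proof.
have c : `|davie_seq k| @[k --> \oo] --> `|davie_lim|.
  by apply: cvg_norm; exact: davie_seq_cvg.
apply: (cvgr_to_ge c); apply: nearW => k.
by rewrite to_completion_norm davie_tensor_norm.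
Qed.

Section functional.
Variables (F : T -> R) (F_linear : linear F) (F_le : forall u, F u <= `|u|).

Let FD u v : F (u + v) = F u + F v.
Proof. by have [_ _] := linear_formP F_linear. Qed.

Let F0 : F 0 = 0.
Proof. by have [] := linear_formP F_linear. Qed.

Let FZ a u : F (a *: u) = a * F u.
Proof. by have [_] := linear_formP F_linear. Qed.

Let FB u v : F (u - v) = F u - F v.
Proof. by rewrite FD -scaleN1r FZ mulN1r. Qed.

Let F_norm u : `|F u| <= `|u|.
Proof.
rewrite ler_norml F_le andbT lerNl.
by rewrite -[- F u]mulN1r -FZ scaleN1r -[leRHS]normrN F_le.
Qed.

Let F_cvg (w : nat -> T) l : w @ \oo --> l -> F (w k) @[k --> \oo] --> F l.
Proof.
move=> wl; apply/cvgrPdist_lt => e e0; near=> k.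
rewrite -FB; apply: le_lt_trans (F_norm _) _; near: k.
by move/cvgrPdist_lt : wl; exact.
Unshelve. all: by end_near. Qed.

Let B x f := F (ptens x f).

Let B_linl f : linear (B^~ f).
Proof.
by move=> a x y; rewrite /B /ptens tensDl tensZl to_completion_linear F_linear.
Qed.

Let B_linr x : linear (B x).
Proof.
by move=> a f g; rewrite /B /ptens tensDr tensZr to_completion_linear F_linear.
Qed.

Let B_norm x f : `|B x f| <= `|x| * `|f|.
Proof. exact: le_trans (F_norm _) (ptens_norm_le _ _). Qed.

Lemma davie_seq_formE k :
  F (davie_seq k) = 2 ^- k * \sum_(j < 2 ^ k) B (vec j) (coef j).
Proof.
by rewrite /davie_seq /davie_tensor ptens_lincomb FZ (big_morph F FD F0).
Qed.

Let linear_coef (phi : dual Y -> R) k (j : 'I_(2 ^ k)) : linear phi ->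
  phi (coef j) = 2 ^- k.+1 * \sum_(g < 2 ^ k.+1) ds_t D k j g *
    phi (coordinate (2 ^ k.+1 + g)%N).
Proof.
move=> /linear_formP[phi0 pZ pD].
rewrite /coef pZ (big_morph phi pD phi0); congr (_ * _).
by apply: eq_bigr => g _; exact: pZ.
Qed.

(** For [w] supported far away and small, [B (x0 + w)] is norming at [f0], so by
    [norming_minor] all these functionals have coordinates proportional to those
    of any one of them that is not zero on the coordinates; [phi] is such a one,
    and by difference the same holds for [B w]. *)
Lemma rank_one_tail (x0 : X) (f0 : dual Y) : x0 != 0 -> f0 != 0 ->
  B x0 f0 = `|x0| * `|f0| ->
  exists N (c : X -> R) (C : R) (phi : dual Y -> R) (M : R),
    [/\ forall x, `|c x| <= C * `|x|, linear phi, forall f, `|phi f| <= M * `|f| &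
      forall w : X, (forall p, (p < N)%N -> (csub_val w : c0 R) p = 0) ->
        forall p, B w (coordinate p) = c w * phi (coordinate p)].
Proof.
move=> x00 f00 Bx0.
have BD v f : B (x0 + v) f = B x0 f + B v f.
  by have [_ _] := linear_formP (B_linl f).
have BZ a v f : B (a *: v) f = a * B v f.
  by have [_] := linear_formP (B_linl f).
have nx0 : 0 < `|x0| by rewrite normr_gt0.
have h0 : 0 < `|x0| / 2 by rewrite divr_gt0.
have [N _ NP] : \forall p \near \oo, `|(csub_val x0 : c0 R) p| < `|x0| / 2.
  have := @c0_cvg _ (csub_val x0).
  move=> /cvgrPdist_lt/(_ _ h0); apply: filterS => p.
  by rewrite sub0r normrN.
pose tail (w : X) := forall p, (p < N)%N -> (csub_val w : c0 R) p = 0.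
have tailZ a w : tail w -> tail (a *: w).
  by move=> tw p pN; rewrite /= fctE tw// scaler0.
have c0_le (x : X) p : `|(csub_val x : c0 R) p| <= `|x| by exact: c0_le_norm.
have ball (w : X) : tail w -> `|w| <= `|x0| / 2 -> `|x0 + w| <= `|x0|.
  move=> tw w2; apply: sup_norm_ub; first by exists 0%N.
  move=> p _; rewrite /= fctE.
  have [pN|pN] := ltnP p N; first by rewrite tw// addr0 c0_le.
  rewrite (le_trans (ler_normD _ _))// [leRHS]splitr lerD//.
    by rewrite ltW// NP.
  exact: le_trans (c0_le _ _) w2.
pose small (w : X) := tail w /\ `|w| <= `|x0| / 2.
have bnd w f : small w -> B (x0 + w) f <= `|x0| * `|f|.
  move=> [tw w2]; apply: le_trans (ler_norm _) _; apply: le_trans (B_norm _ _) _.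
  by rewrite ler_wpM2r// ball.
(* x0 + w and x0 - w both pair with f0 to at most |x0| |f0|, and x0 is their
   mean. *)
have norming w : small w -> B (x0 + w) f0 = `|x0| * `|f0|.
  move=> sw; have [tw w2] := sw.
  have sNw : small (-1 *: w) by split; [exact: tailZ|rewrite normrZ normrN1 mul1r].
  have := bnd _ f0 sw; have := bnd _ f0 sNw.
  by rewrite !BD BZ Bx0; lra.
have minor w w' p q : small w -> small w' ->
    B (x0 + w) (coordinate p) * B (x0 + w') (coordinate q) =
    B (x0 + w) (coordinate q) * B (x0 + w') (coordinate p).
  move=> sw sw'.
  apply: (@norming_minor R d _ (B (x0 + w)) (B (x0 + w')) f0 `|x0|) => //;
    by [exact: B_linr|move=> f; exact: bnd|exact: norming].
have small0 : small 0.
  by split; [move=> p _|rewrite normr0 ltW].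
have scale w : tail w -> exists2 a : R, 0 < a & small (a *: w).
  move=> tw; have w1 : 0 < `|w| + 1 by rewrite ltr_wpDl.
  have a0 : 0 < `|x0| / 2 / (`|w| + 1) by rewrite divr_gt0.
  exists (`|x0| / 2 / (`|w| + 1)) => //; split; first exact: tailZ.
  rewrite normrZ gtr0_norm// -mulrA ler_piMr ?(ltW h0)//.
  by rewrite ler_pdivrMl// mulr1 lerDl.
have [[w1 [q [sw1 w1q]]]|none] := pselect (exists w q,
    small w /\ B (x0 + w) (coordinate q) != 0).
  pose phi := B (x0 + w1); pose a := phi (coordinate q).
  exists N, (fun x => B x (coordinate q) / a), (`|a|^-1), phi, `|x0 + w1|; split.
  - move=> x; rewrite normrM normfV mulrC ler_wpM2l ?invr_ge0//.
    by rewrite (le_trans (B_norm _ _))// ler_piMr// coordinate_norm.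
  - exact: B_linr.
  - exact: B_norm.
  move=> w tw p; have [b b0 sb] := scale w tw.
  have := minor _ _ p q sw1 sb; have := minor _ _ p q sw1 small0.
  rewrite -/phi addr0 !BD !BZ -/a => m0 m1.
  have : b * (a * B w (coordinate p)) =
      b * (phi (coordinate p) * B w (coordinate q)).
    by move: m0 m1; lra.
  move=> /(mulfI (lt0r_neq0 b0)) m2.
  by apply: (mulfI w1q); rewrite -/phi -/a m2; field.
exists N, (fun=> 0), 0, (fun=> 0), 0; split.
- by move=> x; rewrite normr0 mul0r.
- by move=> b f g; rewrite scaler0 addr0.
- by move=> f; rewrite normr0 mul0r.
move=> w tw p; have [b b0 sb] := scale w tw.
have z v : small v -> B (x0 + v) (coordinate p) = 0.
  by move=> sv; apply/eqP; apply: contrapT => /negP h; apply: none; exists v, p.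
have := z _ sb; have := z _ small0; rewrite addr0 BD BZ => ->.
by rewrite add0r => /eqP; rewrite mulf_eq0 (gt_eqF b0)/= => /eqP ->; rewrite mulr0.
Qed.

(** For [k] large the vectors of level [k] have their supports in the tail where [B]
    is [c w * phi f], so that [F (davie_seq k)] is [phi] of a mean of coefficient
    functionals with bounded weights [c (vec j)], and tends to 0. *)
Lemma norming_davie_lim (x0 : X) (f0 : dual Y) : x0 != 0 -> f0 != 0 ->
  B x0 f0 = `|x0| * `|f0| -> F davie_lim = 0.
Proof.
move=> x00 f00 Bx0.
have [N [c [C [phi [M [cC lp pM BE]]]]]] := rank_one_tail x00 f00 Bx0.
have [phi0 pZ pD] := linear_formP lp.
have vec1 k (j : 'I_(2 ^ k)) : `|vec j| <= 1.
  by apply: sup_norm_ub; [exists 0%N|move=> p _; exact: davie_fun_le1].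
pose C' := `|C| + 1; have C'0 : 0 < C' by rewrite ltr_wpDl.
pose M' := `|M| + 1; have M'0 : 0 < M' by rewrite ltr_wpDl.
have cC' k (j : 'I_(2 ^ k)) : `|c (vec j)| <= C'.
  apply: le_trans (cC _) _; apply: (@le_trans _ _ (`|C| * `|vec j|)).
    by rewrite ler_wpM2r// ler_norm.
  by rewrite /C'; have := vec1 k j; have := normr_ge0 C; nra.
have pM' f : `|phi f| <= M' * `|f|.
  apply: le_trans (pM _) _; rewrite ler_wpM2r// /M'.
  by rewrite (le_trans (ler_norm _))// lerDl.
have seqE k : (N <= k)%N -> F (davie_seq k) =
    C' * phi (2 ^- k *: \sum_(j < 2 ^ k) (C'^-1 * c (vec j)) *: coef j).
  move=> Nk; rewrite davie_seq_formE pZ (big_morph phi pD phi0).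
  rewrite mulrCA; congr (_ * _); rewrite mulr_sumr; apply: eq_bigr => j _.
  rewrite pZ mulrA mulVKf ?gt_eqF// (linear_coef _ (B_linr _)) (linear_coef _ lp).
  rewrite mulrCA; congr (_ * _); rewrite mulr_sumr; apply: eq_bigr => g _.
  rewrite BE; first by ring.
  move=> p pN; apply: davie_fun_small; apply: leq_trans pN (leq_trans Nk _).
  by apply: ltnW; apply: leq_trans (ltn_expl _ (ltnSn 1)) _; rewrite leq_exp2l.
have lim0 : F (davie_seq k) @[k --> \oo] --> (0 : R).
  apply/cvgrPdist_le => e e0.
  have [K KP] := coef_mean_small (divr_gt0 e0 (mulr_gt0 C'0 M'0)).
  exists (maxn N K) => // k /=; rewrite geq_max => /andP[Nk Kk].
  rewrite sub0r normrN seqE// normrM gtr0_norm//.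
  apply: le_trans (_ : C' * (M' * (e / (C' * M'))) <= _); last first.
    by rewrite mulrA mulrC divfK// gt_eqF// mulr_gt0.
  rewrite ler_pM2l// (le_trans (pM' _))// ler_pM2l//; apply: KP => // j.
  by rewrite normrM gtr0_norm ?invr_gt0// ler_pdivrMl// mulr1.
exact: cvg_unique (F_cvg davie_seq_cvg) lim0.
Qed.

(** Since [F] has norm at most 1 and attains [|u|], no loss can occur in any term of
    the representation: [F] norms every elementary tensor in it. *)
Lemma attaining_davie_lim u : attains_proj_norm u -> u != 0 -> F u = `|u| ->
  F davie_lim = 0.
Proof.
move=> [x [f [_ _ cn ct]]] u0 Fu.
have cF := F_cvg ct.
have FS k : F (series (fun n => ptens (x n) (f n)) k) =
    series (fun n => B (x n) (f n)) k.
  by rewrite /series/= (big_morph F FD F0).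
pose g n := `|x n| * `|f n| - B (x n) (f n).
have g0 n : 0 <= g n.
  by rewrite subr_ge0 (le_trans (ler_norm _))// B_norm.
have cg : series g @ \oo --> (0 : R).
  rewrite -(subrr `|u|) -{2}Fu.
  have -> : series g = series (fun n => `|x n| * `|f n|) -
      (fun k => F (series (fun n => ptens (x n) (f n)) k)).
    by apply/funext => k; rewrite !fctE FS /series/= -sumrB.
  exact: cvgB.
have gz n : B (x n) (f n) = `|x n| * `|f n|.
  apply/eqP; rewrite eq_sym -subr_eq0 eq_le g0 andbT.
  have := series_ge_term n g0 (cvgP _ cg).
  by rewrite (cvg_lim _ cg).
have [n [xn fn]] : exists n, x n != 0 /\ f n != 0.
  apply: contrapT => /forallNP h; move/eqP : u0; apply.
  apply: normr0_eq0; rewrite -(cvg_lim (@norm_hausdorff _ _) cn).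
  have -> : series (fun n => `|x n| * `|f n|) = cst 0.
    apply/funext => k; rewrite /series/= big1// => n _.
    have [->|xn] := eqVneq (x n) 0; first by rewrite normr0 mul0r.
    have [->|fn] := eqVneq (f n) 0; first by rewrite normr0 mulr0.
    by case: (h n).
  by rewrite lim_cst.
exact: norming_davie_lim xn fn (gz n).
Qed.

End functional.
End norming_functionals.

(** * Norm-attaining tensors are not dense *)

Lemma not_dense_ball (R : realType) (V : normedModType R) (S : set V) z
    (e : R) :
  0 < e -> (forall t, S t -> e <= `|z - t|) -> ~ dense S.
Proof.
move=> e0 far dns; have [t [zt St]] := dns (ball z e)
  (ex_intro _ z (ballxx z e0)) (ball_open z e).
by move: zt; rewrite -ball_normE /ball_ /= ltNge far.
Qed.

Lemma sublinear_norm (R : realType) (V : normedModType R) :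
  sublinear (fun u : V => `|u|).
Proof.
split; first exact: ler_normD.
by move=> a x a0; rewrite normrZ gtr0_norm.
Qed.

Lemma not_dense_attaining (R : realType) (X Z : normedModType R)
    (z : proj_tensor X Z) :
  z != 0 ->
  (forall F : proj_tensor X Z -> R, linear F -> (forall u, F u <= `|u|) ->
    forall u, attains_proj_norm u -> u != 0 -> F u = `|u| -> F z = 0) ->
  ~ dense [set t : proj_tensor X Z | attains_proj_norm t].
Proof.
rewrite -normr_gt0 => z0 kill.
apply: (@not_dense_ball R (proj_tensor X Z) _ z (`|z| / 2)).
  by rewrite divr_gt0.
move=> t att; rewrite leNgt; apply/negP => zt.
have tn : `|z| / 2 < `|t|.
  have : `|z| <= `|z - t| + `|t| by rewrite -{1}(subrK t z) ler_normD.
  lra.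
have t0 : t != 0 by rewrite -normr_gt0; apply: le_lt_trans tn; rewrite divr_ge0.
have [F Fl [Ft Fle]] := hahn_banach t (@sublinear_norm R (proj_tensor X Z)).
have Fz := kill F Fl Fle t att t0 Ft.
have [_ FZ FD] := linear_formP Fl.
have := Fle (t - z); rewrite distrC FD -scaleN1r FZ Fz Ft; lra.
Qed.

Theorem theorem5p1 (R : realType) (d : read_data) :
  exists (X : csubspace (c0 R)) (Y : csubspace (read_space R d)),
    ~ dense [set t : proj_tensor (csub X) (dual (csub Y)) |
               attains_proj_norm t].
Proof.
have [D] := davie_exists R.
exists (davie_X D), (davie_Y D d).
apply: (@not_dense_attaining R _ _ (davie_lim d D)).
  by rewrite -normr_gt0 (lt_le_trans _ (davie_lim_norm d D))// invr_gt0.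
move=> F Fl Fle u; exact: (attaining_davie_lim Fl Fle).
Qed.
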